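(* Let $(P,g,\Phi)$ be a Carrollian $\mathbb{R}^\times$-bundle with a connection over an oriented $n$-dimensional manifold $M$, with $g$ of signature $(1,\ldots,1,0)$ and with Euler vector field $\Delta_P$ Killing for $g$, i.e. $\mathcal{L}_{\Delta_P}g=0$. Let $\delta:\Omega^k(P)\to\Omega^{k-1}(P)$ be the associated de Rham codifferential, $\delta\xi:=(-1)^{1+k(n+1-k)}\star d\star\xi$. If $\xi\in\Omega^k(P)$ is homogeneous of weight $\lambda\in\mathbb{R}$, i.e. $\mathcal{L}_{\Delta_P}\xi=\lambda\,\xi$, then $\delta\xi\in\Omega^{k-1}(P)$ is also homogeneous of weight $\lambda$, i.e. $\mathcal{L}_{\Delta_P}(\delta\xi)=\lambda\,\delta\xi$.
   Context: $\mathbb{R}^\times=\mathbb{R}\setminus\{0\}$ is the multiplicative group. Let $\pi:P\to M$ be a smooth principal $\mathbb{R}^\times$-bundle with $\dim M=n$, so $\dim P=n+1$. The Euler vector field $\Delta_P$ is the fundamental vector field of the action, i.e. the generator of $p\mapsto e^{s}\cdot p$, $s\in\mathbb{R}$; in local coordinates $(x^a,t)$ adapted to a trivialisation, $\Delta_P=t\,\partial_t$. It spans the sections of the vertical bundle $VP=\ker(d\pi)$. A Carrollian $\mathbb{R}^\times$-bundle is such a $P$ equipped with a degenerate metric $g$ (a smooth symmetric covariant 2-tensor) such that $\ker(g):=\{X\in\mathrm{Vect}(P) : g(X,-)=0\}$ equals the module of sections of $VP$. Here $g$ has signature $(1,\ldots,1,0)$, i.e. it is positive semi-definite of rank $n$.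 The connection $\Phi$ is a principal $\mathbb{R}^\times$-connection, with connection one-form $\theta\in\Omega^1(P)$: a globally defined real-valued $\mathbb{R}^\times$-invariant one-form with $\theta(\Delta_P)=1$ (so $\mathcal{L}_{\Delta_P}\theta=0$); locally $\theta=t^{-1}dt+A_a(x)\,dx^a$. The tensor $G:=g-\theta\otimes\theta$ is a non-degenerate Lorentzian metric on $P$ of signature $(1,\ldots,1,-1)$. $M$ is oriented, and $P$ is given the orientation in which $e^1\wedge\cdots\wedge e^n\wedge\theta$ is positive whenever $\{e^a\}$ is a local oriented coframe of forms annihilating $\Delta_P$ (oriented via $M$). $\mathsf{Vol}_P$ denotes the corresponding metric volume form of $G$; when $g=\pi^*g_M$ for a metric $g_M$ on $M$ with volume form $\mathsf{Vol}_M$, it is $\mathsf{Vol}_P=(-1)^n\theta\wedge\mathsf{Vol}_M$. The Hodge star of $\xi\in\Omega^k(P)$ is the unique $(n+1-k)$-form $\star\xi$ with $\eta\wedge\star\xi=\langle\eta,\xi\rangle_G\,\mathsf{Vol}_P$ for all $\eta\in\Omega^k(P)$, where $\langle\cdot,\cdot\rangle_G$ is the pointwise inner product on $k$-forms induced by $G$. $d$ is the de Rham differential on $P$. *)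

(* Defs.v *)
From HB Require Import structures.
From mathcomp Require Import all_boot all_order all_algebra.
From mathcomp Require Import all_classical all_reals all_analysis ring.

Set Implicit Arguments.
Unset Strict Implicit.
Unset Printing Implicit Defensive.

Import Order.TTheory GRing.Theory Num.Theory.
Import numFieldNormedType.Exports.
Local Open Scope classical_set_scope.
Local Open Scope ring_scope.

Section SmoothFunctions.
Context {R : realType}.

Fixpoint Ck (k m : nat) (U : set 'rV[R]_m) (f : 'rV[R]_m -> R) : Prop :=
  if k is k'.+1 then
    (forall x, U x -> differentiable f x) /\
    (forall v : 'rV[R]_m, Ck k' U (fun x => 'D_v f x))
  else forall x, U x -> {for x, continuous f}.

Definition smooth_on m (U : set 'rV[R]_m) (f : 'rV[R]_m -> R) : Prop :=
  forall k, Ck k U f.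

Lemma near_eq_differentiable (V W : normedModType R) (f g : V -> W) (x : V) :
  (\near x, f x = g x) -> differentiable f x -> differentiable g x.
Proof.
move=> fg df; have gx : g x = f x by rewrite (nbhs_singleton fg).
have dfc : continuous ('d f x) by exact: diff_continuous.
have H : g \o shift x = cst (g x) + 'd f x +o_ 0 id.
  apply/eqaddoP => e e0.
  have /eqaddoP/(_ e e0) h := diff_locally df.
  have h2 : \forall y \near (0 : V), f (y + x) = g (y + x).
    move: fg; rewrite (near_shift 0 x) => fg.
    by apply: filterS fg => y /=; rewrite subr0.
  apply: filterS2 h h2 => y; rewrite gx => + fgy.
  by rewrite ![(_ - _) y]/(_ + _)/= fgy.
by apply/diff_locallyP; rewrite (diff_unique dfc H).
Qed.

Lemma open_near m (U : set 'rV[R]_m) (P : 'rV[R]_m -> Prop) x : open U -> U x ->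
  (forall y, U y -> P y) -> \near x, P x.
Proof. by move=> oU Ux UP; apply: filterS UP _; exact: open_nbhs_nbhs. Qed.

Lemma Ck_sub k m (U V : set 'rV[R]_m) f : U `<=` V -> Ck k V f -> Ck k U f.
Proof.
elim: k f => [|k IH] f UV /=; first by move=> h x /UV /h.
by move=> [h1 h2]; split=> [x /UV /h1|v] //; apply: IH.
Qed.

Lemma Ck_local k m (U : set 'rV[R]_m) f :
  (forall x, U x -> exists2 V : set 'rV[R]_m, V x & Ck k V f) -> Ck k U f.
Proof.
elim: k f => [|k IH] f /= h; first by move=> x /h [V Vx]; apply.
split=> [x /h [V Vx [+ _]]|v]; first exact.
by apply: IH => x /h [V Vx [_ ?]]; exists V.
Qed.

Lemma Ck_congr k m (U : set 'rV[R]_m) f g : open U ->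
  (forall x, U x -> f x = g x) -> Ck k U f -> Ck k U g.
Proof.
move=> oU; elim: k f g => [|k IH] f g fg /=.
  move=> h x Ux; have := h x Ux; rewrite /prop_for /continuous_at -(fg x Ux).
  by apply: cvg_trans; exact/(near_eq_cvg (F := nbhs x))/(open_near oU Ux fg).
move=> [h1 h2]; split=> [x Ux|v].
  by apply: (near_eq_differentiable (@open_near _ _ (fun y => f y = g y) x oU Ux fg)); exact: h1.
apply: IH (h2 v) => x Ux.
by apply: near_eq_derive; exact: (@open_near _ _ (fun y => f y = g y) x oU Ux fg).
Qed.

Lemma Ck_continuous k m (U : set 'rV[R]_m) f :
  Ck k U f -> forall x, U x -> {for x, continuous f}.
Proof.
case: k => [//|k] [df _] x Ux.
by apply: differentiable_continuous; exact: df.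
Qed.

Lemma Ck_pred k m (U : set 'rV[R]_m) f : Ck k.+1 U f -> Ck k U f.
Proof.
elim: k f => [|k IH] f; first exact: Ck_continuous.
by move=> [h1 h2]; split => // v; apply: IH.
Qed.

Lemma Ck_cst k m (U : set 'rV[R]_m) (a : R) : Ck k U (fun=> a).
Proof.
elim: k a => [|k IH] a /=; first by move=> x _; exact: cst_continuous.
split=> [x _|v]; first exact: (differentiable_cst (a : R^o) x).
have -> : (fun x : 'rV[R]_m => 'D_v (fun=> a) x) = fun=> 0.
  by apply/funext => x; exact: derive_cst.
exact: IH.
Qed.

Lemma CkD k m (U : set 'rV[R]_m) f g : open U ->
  Ck k U f -> Ck k U g -> Ck k U (fun x => f x + g x).
Proof.
move=> oU; elim: k f g => [|k IH] f g /=.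
  by move=> cf cg x Ux; apply: (@continuousD R R^o _ f g); [exact: cf|exact: cg].
move=> [df Df] [dg Dg]; split=> [x Ux|v].
  by apply: differentiableD; [exact: df|exact: dg].
apply: (Ck_congr oU _ (IH _ _ (Df v) (Dg v))) => x Ux.
by rewrite -deriveD//; apply: diff_derivable; [exact: df|exact: dg].
Qed.

Lemma CkM k m (U : set 'rV[R]_m) f g : open U ->
  Ck k U f -> Ck k U g -> Ck k U (fun x => f x * g x).
Proof.
move=> oU; elim: k f g => [|k IH] f g.
  by move=> cf cg x Ux; apply: (@continuousM R _ f g); [exact: cf|exact: cg].
move=> Cf Cg; have [df Df] := Cf; have [dg Dg] := Cg; split=> [x Ux|v].
  by apply: differentiableM; [exact: df|exact: dg].
have h := CkD oU (IH _ _ (Ck_pred Cf) (Dg v)) (IH _ _ (Ck_pred Cg) (Df v)).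
apply: (Ck_congr oU _ h) => x Ux.
by rewrite -deriveM//; apply: diff_derivable; [exact: df|exact: dg].
Qed.

Lemma Ck_sum k m (U : set 'rV[R]_m) l (f : 'I_l -> 'rV[R]_m -> R) : open U ->
  (forall i, Ck k U (f i)) -> Ck k U (fun x => \sum_i f i x).
Proof.
move=> oU; elim: l f => [|l IH] f Cf.
  have -> : (fun x => \sum_i f i x) = fun=> 0.
    by apply/funext => x; rewrite big_ord0.
  exact: Ck_cst.
have -> : (fun x => \sum_i f i x) =
    fun x => (f ord0 x + \sum_(i < l) f (lift ord0 i) x).
  by apply/funext => x; rewrite big_ord_recl.
by apply: CkD => //; apply: IH.
Qed.

Lemma differentiable_rV m l (F : 'rV[R]_m -> 'rV[R]_l) x :
  (forall j, differentiable (fun y => F y ord0 j) x) -> differentiable F x.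
Proof.
move=> dF; have -> : F = \sum_j (fun y => F y ord0 j *: delta_mx ord0 j).
  by apply/funext => y; rewrite fct_sumE -row_sum_delta.
by apply: differentiable_sum => j; exact: differentiableZl.
Qed.

Lemma Ck_comp k m l (U : set 'rV[R]_m) (V : set 'rV[R]_l)
    (F : 'rV[R]_m -> 'rV[R]_l) f : open U ->
  (forall x, U x -> V (F x)) -> (forall j, Ck k U (fun x => F x ord0 j)) ->
  Ck k V f -> Ck k U (fun x => f (F x)).
Proof.
move=> oU UV; elim: k f => [|k IH] f CF Cf.
  move=> x Ux; apply: (@continuous_comp _ _ _ F f); last by apply: Cf; exact: UV.
  move=> A [P PF PA].
  have h : \forall y \near x, forall i j, P i j (F y i j).
    apply: (@filter_forall _ _ (fun i y => forall j, P i j (F y i j))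
      (nbhs x) (nbhs_filter x)) => i.
    apply: (@filter_forall _ _ (fun j y => P i j (F y i j))
      (nbhs x) (nbhs_filter x)) => j.
    have := PF i j; rewrite (ord1 i) => PFj; exact: (CF j x Ux _ PFj).
  by apply: filterS h => y hy; apply: PA.
have [df Df] := Cf.
have dF x : U x -> differentiable F x.
  by move=> Ux; apply: differentiable_rV => j; have [+ _] := CF j; exact.
split=> [x Ux|v].
  by apply: (@differentiable_comp _ _ _ _ F f); [exact: dF|apply/df/UV].
have C j : Ck k U (fun x => 'D_(delta_mx ord0 j) f (F x) *
                            'D_v (fun y => F y ord0 j) x).
  apply: CkM => //; last by have [_] := CF j; exact.
  apply: (IH (fun y => 'D_(delta_mx ord0 j) f y)); last exact: Df.
  by move=> i; exact/Ck_pred/CF.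
apply: (Ck_congr oU _ (Ck_sum oU C)) => x Ux.
rewrite [RHS]deriveE; last first.
  by apply: (@differentiable_comp _ _ _ _ F f); [exact: dF|apply/df/UV].
rewrite (@diff_comp _ _ _ _ F f); [|exact: dF|exact/df/UV].
rewrite /= -(deriveE _ (dF x Ux)) derive_mx; last exact/diff_derivable/dF.
rewrite [X in 'd f _ X]row_sum_delta linear_sum; apply: eq_bigr => j _.
by rewrite linearZ /= -deriveE; [rewrite mxE mulrC|exact/df/UV].
Qed.

End SmoothFunctions.

Section Manifolds.
Context {R : realType}.

(* [cinv] is meant as the inverse of the homeomorphism
   [cfun : cdom -> cfun @` cdom]; both maps carry junk values elsewhere. *)
Record chart (n : nat) (M : topologicalType) := Chart {
  cdom : set M;
  cfun : M -> 'rV[R]_n;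
  cinv : 'rV[R]_n -> M }.

Definition cimg n (M : topologicalType) (c : chart n M) : set 'rV[R]_n :=
  cfun c @` cdom c.

Definition is_chart n (M : topologicalType) (c : chart n M) : Prop :=
  [/\ open (cdom c), open (cimg c),
      forall x, cdom c x -> cinv c (cfun c x) = x,
      forall x, cdom c x -> {for x, continuous (cfun c)} &
      forall u, cimg c u -> {for u, continuous (cinv c)}].

Definition smooth_transition n (M : topologicalType) (c c' : chart n M) : Prop :=
  forall j, smooth_on (cfun c @` (cdom c `&` cdom c'))
                      (fun u => cfun c' (cinv c u) ord0 j).

Record manifold (n : nat) := Manifold {
  mcarrier :> topologicalType;
  atlas : set (chart n mcarrier);
  atlas_chart : forall c, atlas c -> is_chart c;
  atlas_cover : forall x, exists2 c, atlas c & cdom c x;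
  atlas_compat : forall c c', atlas c -> atlas c' -> smooth_transition c c';
  manifold_hausdorff : hausdorff_space mcarrier;
  manifold_countable : @second_countable mcarrier }.

(* Membership in the maximal atlas. *)
Definition smooth_chart n (M : manifold n) (c : chart n M) : Prop :=
  is_chart c /\
  forall c', atlas c' -> smooth_transition c c' /\ smooth_transition c' c.

Definition smooth_fun n (M : manifold n) (f : M -> R) : Prop :=
  forall c : chart n M, atlas c -> smooth_on (cimg c) (fun u => f (cinv c u)).

Definition smooth n m (M : manifold n) (N : manifold m) (F : M -> N) : Prop :=
  continuous F /\
  forall (c : chart n M) (c' : chart m N), atlas c -> atlas c' ->
  forall j, smooth_on (cfun c @` (cdom c `&` F @^-1` cdom c'))
                      (fun u => cfun c' (F (cinv c u)) ord0 j).

Lemma cinv_dom n (M : manifold n) (c : chart n M) u :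
  atlas c -> cimg c u -> cdom c (cinv c u) /\ cfun c (cinv c u) = u.
Proof.
by move=> /atlas_chart [_ _ K _ _] [x cx <-]; rewrite !K.
Qed.

Lemma smooth_fun_comp n m (M : manifold n) (N : manifold m) (F : M -> N) f :
  smooth F -> smooth_fun f -> smooth_fun (fun x => f (F x)).
Proof.
move=> [cF sF] sf c ac k; apply: Ck_local => u cu.
have [du Eu] := cinv_dom ac cu.
have [c' ac' c'F] := atlas_cover (F (cinv c u)).
have [oc oi K cc ci] := atlas_chart ac.
have [oc' oi' K' cc' ci'] := atlas_chart ac'.
set V := cfun c @` (cdom c `&` F @^-1` cdom c').
have VE : V = cimg c `&` (fun v => F (cinv c v)) @^-1` cdom c'.
  apply/seteqP; split=> [_ [x [cx Fx] <-]|v [cv Fv]].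
    by split; [exists x|rewrite /preimage/= K].
  have [dv Ev] := cinv_dom ac cv.
  by exists (cinv c v); [split|].
have oV : open V.
  rewrite VE openE => v [cv Fv]; apply: filterI; first exact: open_nbhs_nbhs.
  have h : nbhs (F (cinv c v)) (cdom c') by exact: open_nbhs_nbhs.
  exact: (ci v cv _ (cF (cinv c v) _ h)).
exists V; first by rewrite VE; split.
have VF v : V v -> cimg c' (cfun c' (F (cinv c v))).
  by rewrite VE => -[_ Fv]; exists (F (cinv c v)).
apply: (@Ck_congr _ _ _ _
  (fun v => f (cinv c' (cfun c' (F (cinv c v)))))) => // [v|].
  by rewrite VE => -[_ Fv]; rewrite K'.
apply: (@Ck_comp _ _ _ _ V (cimg c') (fun v => cfun c' (F (cinv c v)))
  (fun w => f (cinv c' w))) => //.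
- by move=> j; exact: sF.
- exact: sf.
Qed.

End Manifolds.

Arguments manifold R n : clear implicits.

Section SmoothRing.
Context {R : realType} {n : nat}.
Variable M : manifold R n.

Definition smooth_pred : {pred M -> R} := fun f => `[< smooth_fun f >].

Record Cinf := MkCinf { cinf_fun :> M -> R; _ : cinf_fun \in smooth_pred }.

HB.instance Definition _ := [isSub for cinf_fun].
HB.instance Definition _ := [Choice of Cinf by <:].

Lemma smooth_subring : subring_closed smooth_pred.
Proof.
have oi (c : chart n M) : atlas c -> open (cimg c) by move=> /atlas_chart [].
split.
- by apply/asboolP => c _ k; exact: Ck_cst.
- move=> f g /asboolP sf /asboolP sg; apply/asboolP => c ac k.
  apply: (@CkD _ _ _ _ (fun u => f (cinv c u)) (fun u => - g (cinv c u))).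
  + exact: oi.
  + exact: sf.
  + have h := CkM (oi c ac) (Ck_cst k (cimg c) (-1)) (sg c ac k).
    by apply: (Ck_congr (oi c ac) _ h) => u _; rewrite mulN1r.
- move=> f g /asboolP sf /asboolP sg; apply/asboolP => c ac k.
  apply: CkM; [exact: oi|exact: sf|exact: sg].
Qed.

HB.instance Definition _ :=
  GRing.isSubringClosed.Build (M -> R) smooth_pred smooth_subring.
HB.instance Definition _ :=
  GRing.SubChoice_isSubComPzRing.Build _ _ Cinf (GRing.Theory.subringClosedP _).

Lemma CinfP (f g : Cinf) : f =1 g -> f = g.
Proof. by move=> fg; apply/val_inj/funext. Qed.

Lemma Cinf_smooth (f : Cinf) : smooth_fun f.
Proof. by case: f => f /= /asboolP. Qed.

Lemma smooth_cst (a : R) : (fun=> a) \in smooth_pred.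
Proof. by apply/asboolP => c _ k; exact: Ck_cst. Qed.

Definition Ccst (a : R) : Cinf := MkCinf (smooth_cst a).

Fact Ccst_scaleA a b (f : Cinf) : Ccst a * (Ccst b * f) = Ccst (a * b) * f.
Proof. by apply: CinfP => p; exact: mulrA. Qed.
Fact Ccst_scale1 : left_id 1 (fun a (f : Cinf) => Ccst a * f).
Proof. by move=> f; apply: CinfP => p; exact: mul1r. Qed.
Fact Ccst_scaleDr : right_distributive (fun a (f : Cinf) => Ccst a * f) +%R.
Proof. by move=> a f g; exact: mulrDr. Qed.
Fact Ccst_scaleDl (f : Cinf) :
  {morph (fun a => Ccst a * f) : a b / a + b >-> a + b}.
Proof. by move=> a b; apply: CinfP => p; exact: mulrDl. Qed.

HB.instance Definition _ := GRing.Zmodule_isLmodule.Build R Cinf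
  Ccst_scaleA Ccst_scale1 Ccst_scaleDr Ccst_scaleDl.

Lemma CinfD (f g : Cinf) p : (f + g) p = f p + g p. Proof. by []. Qed.
Lemma CinfN (f : Cinf) p : (- f) p = - f p. Proof. by []. Qed.
Lemma CinfM (f g : Cinf) p : (f * g) p = f p * g p. Proof. by []. Qed.
Lemma CinfZ a (f : Cinf) p : (a *: f) p = a * f p. Proof. by []. Qed.

End SmoothRing.

Section VectorFields.
Context {R : realType} {n : nat}.
Variable M : manifold R n.

(* Vector fields are the derivations of the R-algebra C^oo(M). *)
Definition is_derivation (X : Cinf M -> Cinf M) : Prop :=
  (forall (a : R) f h, X (a *: f + h) = a *: X f + X h) /\
  (forall f h, X (f * h) = f * X h + h * X f).

Definition derivation_pred : {pred Cinf M -> (Cinf M)^o} :=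
  fun X => `[< is_derivation X >].

Record vect := MkVect {
  vect_op : Cinf M -> (Cinf M)^o;
  _ : vect_op \in derivation_pred }.

Definition vect_fun (X : vect) : Cinf M -> Cinf M := vect_op X.
Coercion vect_fun : vect >-> Funclass.

HB.instance Definition _ := [isSub for vect_op].
HB.instance Definition _ := [Choice of vect by <:].

Lemma derivation_submod : submod_closed derivation_pred.
Proof.
split.
- have E k p : ((0 : Cinf M -> (Cinf M)^o) k : Cinf M) p = 0 by [].
  apply/asboolP; split=> [a f h|f h]; apply: CinfP => p.
    by rewrite CinfD CinfZ !E mulr0 addr0.
  by rewrite CinfD !CinfM !E !mulr0 addr0.
- move=> u X Y /asboolP [lX dX] /asboolP [lY dY].
  have H : is_derivation (fun k => u * (X k : Cinf M) + (Y k : Cinf M)).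
    split=> [a f h|f h]; apply: CinfP => p.
      by rewrite lX lY !(CinfD, CinfZ, CinfM); ring.
    by rewrite dX dY !(CinfD, CinfM); ring.
  by apply/asboolP; exact: H.
Qed.

HB.instance Definition _ := GRing.isSubmodClosed.Build (Cinf M)
  (Cinf M -> (Cinf M)^o) derivation_pred derivation_submod.
HB.instance Definition _ :=
  GRing.SubChoice_isSubLmodule.Build _ _ _ vect (GRing.subsemimodClosedP _).

Lemma vectP (X Y : vect) : (forall f, X f = Y f) -> X = Y.
Proof. by move=> XY; apply/val_inj/funext. Qed.

Lemma vect_derivation (X : vect) : is_derivation X.
Proof. by case: X => X hX; exact: (asboolW hX). Qed.

Lemma vectD (X Y : vect) f : (X + Y) f = X f + Y f. Proof. by []. Qed.
Lemma vectZ (u : Cinf M) (X : vect) f : (u *: X) f = u * X f. Proof. by []. Qed.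

Lemma mk_derivation (X : Cinf M -> Cinf M) :
  is_derivation X -> (X : _ -> (Cinf M)^o) \in derivation_pred.
Proof. by move=> ?; apply/asboolP. Qed.

Lemma bracket_derivation (X Y : vect) :
  is_derivation (fun f => X (Y f) - Y (X f)).
Proof.
have [lX dX] := vect_derivation X; have [lY dY] := vect_derivation Y.
have XD f h : X (f + h) = X f + X h.
  by rewrite -[in LHS](scale1r f) lX scale1r.
have YD f h : Y (f + h) = Y f + Y h.
  by rewrite -[in LHS](scale1r f) lY scale1r.
split=> [a f h|f h]; apply: CinfP => p.
  by rewrite lY lX lX lY !(CinfD, CinfN, CinfZ); ring.
by rewrite dX dY XD YD !dX !dY !(CinfD, CinfN, CinfM); ring.
Qed.

Definition bracket (X Y : vect) : vect := MkVect (mk_derivation (bracket_derivation X Y)).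

End VectorFields.

Section Pushforward.
Context {R : realType} {n m : nat}.
Variables (M : manifold R n) (N : manifold R m).

Lemma comp_Cinf_subproof (F : M -> N) (f : Cinf N) :
  smooth F -> (fun x => f (F x)) \in @smooth_pred _ _ M.
Proof. by move=> sF; apply/asboolP/smooth_fun_comp/Cinf_smooth. Qed.

Definition comp_Cinf (F : M -> N) (sF : smooth F) (f : Cinf N) : Cinf M :=
  MkCinf (comp_Cinf_subproof f sF).

Record diffeo := Diffeo {
  dfun :> M -> N;
  dinv : N -> M;
  dfunK : cancel dfun dinv;
  dinvK : cancel dinv dfun;
  dfun_smooth : smooth dfun;
  dinv_smooth : smooth dinv }.

End Pushforward.

Section Diffeo.
Context {R : realType} {n m : nat}.
Context {M : manifold R n} {N : manifold R m}.
Variable F : diffeo M N.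

Lemma push_derivation (X : vect M) : is_derivation (fun f : Cinf N =>
  comp_Cinf (dinv_smooth F) (X (comp_Cinf (dfun_smooth F) f))).
Proof.
have [lX dX] := vect_derivation X.
split=> [a f h|f h]; apply: CinfP => q.
  have -> : comp_Cinf (dfun_smooth F) (a *: f + h) =
      a *: comp_Cinf (dfun_smooth F) f + comp_Cinf (dfun_smooth F) h.
    exact: CinfP.
  by rewrite lX.
have -> : comp_Cinf (dfun_smooth F) (f * h) =
    comp_Cinf (dfun_smooth F) f * comp_Cinf (dfun_smooth F) h.
  exact: CinfP.
rewrite dX; set a := X _; set b := X _.
change (f (F (dinv F q)) * a (dinv F q) + h (F (dinv F q)) * b (dinv F q) =
        f q * a (dinv F q) + h q * b (dinv F q)).
by rewrite dinvK.
Qed.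

Definition push (X : vect M) : vect N := MkVect (mk_derivation (push_derivation X)).

End Diffeo.

(* Covariant tensors as maps on finite sequences of vector fields, so that the
   degree is a property ([is_tensor k]) and not part of the type: a tensor of
   degree k vanishes on sequences of length other than k.  Tensor fields are
   thus identified with C^oo-multilinear maps on Vect(M) = Der C^oo(M). *)
Section Tensors.
Context {R : realType} {n : nat}.
Variable M : manifold R n.

Definition tensor := seq (vect M) -> Cinf M.

Definition is_tensor (k : nat) (T : tensor) : Prop :=
  (forall s, size s != k -> T s = 0) /\
  (forall s1 s2 (u : Cinf M) (X Y : vect M),
    T (s1 ++ (u *: X + Y) :: s2) = u * T (s1 ++ X :: s2) + T (s1 ++ Y :: s2)).

Definition is_form (k : nat) (w : tensor) : Prop :=
  is_tensor k w /\
  forall s1 s2 s3 X, w (s1 ++ X :: s2 ++ X :: s3) = 0.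

End Tensors.

Section Forms.
Context {R : realType} {n : nat} {M : manifold R n}.
Implicit Types (w eta : tensor M) (s : seq (vect M)).

Definition subfam s (A : {set 'I_(size s)}) : seq (vect M) :=
  [seq tnth (in_tuple s) i | i <- enum A].

(* Exponent of the sign of the shuffle listing A in increasing order and then
   its complement in increasing order. *)
Definition inversions k (A : {set 'I_k}) : nat :=
  #|[set ij : 'I_k * 'I_k | [&& ij.1 \in A, ij.2 \notin A & (ij.2 < ij.1)%N]]%SET|.

(* Sum over shuffles: the convention in which
   (a /\ b)(X, Y) = a(X) b(Y) - a(Y) b(X) for one-forms; for w of degree k
   only the sets A of cardinal k contribute. *)
Definition wedge w eta : tensor M := fun s =>
  \sum_(A : {set 'I_(size s)})
    (-1) ^+ inversions A * (w (subfam A) * eta (subfam (~: A)%SET)).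

(* De Rham differential, by the Koszul formula. *)
Definition extd w : tensor M := fun s =>
  \sum_(i < size s)
    (-1) ^+ i * tnth (in_tuple s) i (w (subfam [set~ i]%SET)) +
  \sum_(i < size s) \sum_(j < size s | (i < j)%N)
    (-1) ^+ (i + j) *
    w (bracket (tnth (in_tuple s) i) (tnth (in_tuple s) j) ::
       subfam (~: [set i; j])%SET).

Definition pull (F : diffeo M M) w : tensor M := fun s =>
  comp_Cinf (dfun_smooth F) (w [seq push F X | X <- s]).

(* t is the Lie derivative of w along the generator of the flow: the derivative
   at 0 of the pullbacks of w by the flow. *)
Definition is_lie_derivative (flow : R -> diffeo M M) w (t : tensor M) : Prop :=
  forall s p, is_derive (0 : R) (1 : R) (fun u => pull (flow u) w s p) (t s p).

Definition is_tangent (p : M) (v : Cinf M -> R) : Prop :=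
  (forall (a : R) f h, v (a *: f + h) = a * v f + v h) /\
  (forall f h, v (f * h) = f p * v h + h p * v f).

(* The values of the E i at p form a basis of the tangent space at p. *)
Definition frame_at (p : M) (E : 'I_n -> vect M) : Prop :=
  forall v, is_tangent p v ->
  exists! c : 'rV[R]_n, forall f, v f = \sum_i c ord0 i * E i f p.

Definition list_of k (E : 'I_k -> vect M) : seq (vect M) :=
  [seq E i | i <- enum 'I_k].

(* An orientation is given by a nowhere vanishing form of top degree. *)
Definition orientation_form (mu : tensor M) : Prop :=
  is_form n mu /\
  forall p, exists2 E, frame_at p E & mu (list_of E) p != 0.

End Forms.

Section Bundle.
Context {R : realType} {n : nat}.

(* A chart (t, x) of P adapted to a trivialisation of P over the domain of the
   chart x of M. *)
Definition adapted (P : manifold R n.+1) (M : manifold R n)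
    (proj : P -> M) (act : R -> P -> P) (c : chart n M) (t : P -> R)
    (c' : chart n.+1 P) : Prop :=
  [/\ cdom c' = proj @^-1` cdom c,
      forall p, cdom c (proj p) ->
        cfun c' p = row_mx (t p)%:M (cfun c (proj p)) :> 'rV[R]_(1 + n),
      cimg c' = [set u | exists a v, [/\ a != 0, cimg c v &
        u = row_mx a%:M v :> 'rV[R]_(1 + n)]] &
      forall a p, a != 0 -> cdom c (proj p) -> t (act a p) = a * t p].

(* [act a] is only meaningful for a != 0.  Local triviality makes the action
   jointly smooth, free and transitive on the fibres of the surjection proj; it
   also implies [proj_smooth], [proj_submersion] and [act_smooth]. *)
Record principal_bundle (P : manifold R n.+1) (M : manifold R n) :=
  PrincipalBundle {
  proj : P -> M;
  act : R -> P -> P;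
  proj_smooth : smooth proj;
  proj_submersion : forall p w, is_tangent (proj p) w ->
    exists2 v, is_tangent p v &
      forall h : Cinf M, v (comp_Cinf proj_smooth h) = w h;
  act_smooth : forall a, a != 0 -> smooth (act a);
  act1 : forall p, act 1 p = p;
  actM : forall a b p, a != 0 -> b != 0 -> act (a * b) p = act a (act b p);
  proj_act : forall a p, a != 0 -> proj (act a p) = proj p;
  locally_trivial : forall x : M, exists c t c',
    [/\ smooth_chart c, cdom c x, smooth_chart c' & adapted proj act c t c'] }.

Context {P : manifold R n.+1} {M : manifold R n}.
Variable B : principal_bundle P M.

Lemma act_invK a : a != 0 -> cancel (act B a) (act B a^-1).
Proof. by move=> a0 p; rewrite -actM ?invr_eq0// mulVf// act1. Qed.

Lemma act_invKV a : a != 0 -> cancel (act B a^-1) (act B a).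
Proof. by move=> a0 p; rewrite -actM ?invr_eq0// mulfV// act1. Qed.

Lemma act_inv_smooth a : a != 0 -> smooth (act B a^-1).
Proof. by move=> a0; apply: act_smooth; rewrite invr_eq0. Qed.

Definition act_diffeo a (a0 : a != 0) : diffeo P P :=
  Diffeo (act_invK a0) (act_invKV a0) (act_smooth B a0) (act_inv_smooth a0).

Lemma expR_neq0 (s : R) : expR s != 0.
Proof. by rewrite gt_eqF// expR_gt0. Qed.

(* The flow of the Euler vector field. *)
Definition euler_flow (s : R) : diffeo P P := act_diffeo (expR_neq0 s).

Definition is_euler (D : vect P) : Prop :=
  forall (f : Cinf P) p, is_derive (0 : R) (1 : R) (fun s => f (euler_flow s p)) (D f p).

Definition homogeneous (lambda : R) (w : tensor P) : Prop :=
  is_lie_derivative euler_flow w (lambda *: w).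

Definition vertical (X : vect P) : Prop :=
  forall h : Cinf M, X (comp_Cinf (proj_smooth B) h) = 0.

Definition carrollian (g : tensor P) : Prop :=
  [/\ is_tensor 2 g,
      forall X Y, g [:: X; Y] = g [:: Y; X],
      forall X, (forall Y, g [:: X; Y] = 0) <-> vertical X &
      forall p, exists2 E, frame_at p E &
        forall i j, g [:: E i; E j] p = ((i == j) && (i != ord_max))%:R].

Definition connection_form (D : vect P) (theta : tensor P) : Prop :=
  [/\ is_form 1 theta,
      forall a (a0 : a != 0), pull (act_diffeo a0) theta = theta &
      theta [:: D] = 1].

Definition is_pullback (mu : tensor M) (nu : tensor P) : Prop :=
  is_form n nu /\
  forall p (X : 'I_n -> vect P) (Y : 'I_n -> vect M),
    (forall i h, X i (comp_Cinf (proj_smooth B) h) p = Y i h (proj B p)) ->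
    nu (list_of X) p = mu (list_of Y) (proj B p).

Variables (mu : tensor M) (g theta : tensor P).

Definition metric (X Y : vect P) : Cinf P :=
  g [:: X; Y] - theta [:: X] * theta [:: Y].

Definition lsign (i : 'I_n.+1) : R := if i == ord_max then -1 else 1.

Definition orthonormal_at (p : P) (E : 'I_n.+1 -> vect P) : Prop :=
  forall i j, metric (E i) (E j) p = if i == j then lsign i else 0.

(* P is oriented by pi^* mu /\ theta: a wedge product of an oriented coframe of
   forms annihilating the Euler field is a positive multiple of pi^* mu.  The
   pullback exists and is unique, so the quantifier on nu is harmless. *)
Definition positive_at (p : P) (E : 'I_n.+1 -> vect P) : Prop :=
  forall nu, is_pullback mu nu -> 0 < wedge nu theta (list_of E) p.

Definition is_vol (v : tensor P) : Prop :=
  is_form n.+1 v /\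
  forall p E, orthonormal_at p E -> positive_at p E -> v (list_of E) p = 1.

Definition vol : tensor P := xget 0 [set v | is_vol v].

(* For E orthonormal at p, the inner product at p of k-forms induced by the
   metric; it does not depend on E. *)
Definition inner (E : 'I_n.+1 -> vect P) (k : nat) (eta xi : tensor P) (p : P) : R :=
  \sum_(A : {set 'I_n.+1} | #|A| == k)
    (\prod_(i in A) lsign i) *
    (eta [seq E i | i <- enum A] p * xi [seq E i | i <- enum A] p).

Definition is_hodge (k : nat) (xi sigma : tensor P) : Prop :=
  [/\ (k <= n.+1)%N, is_form (n.+1 - k) sigma &
      forall eta, is_form k eta ->
      forall p E, orthonormal_at p E ->
      forall s, wedge eta sigma s p = inner E k eta xi p * vol s p].

(* Zero when k > n + 1, i.e. when there are no nonzero k-forms. *)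
Definition star (k : nat) (xi : tensor P) : tensor P :=
  xget 0 [set sigma | is_hodge k xi sigma].

(* Here xi has degree k, hence extd (star k xi) has degree n + 2 - k. *)
Definition codiff (k : nat) (xi : tensor P) : tensor P :=
  (-1) ^+ (1 + k * (n.+1 - k)) *: star (n.+1 - k).+1 (extd (star k xi)).

End Bundle.

(* Main.v *)
(* A homogeneous form satisfies the linear ODE h' = lambda h along the Euler
   flow, so homogeneity of weight lambda means that pulling back by the flow at
   time u multiplies by exp (lambda u).  The flow preserves g (Killing), theta
   (principal connection) and the projection to M, hence the set of volume
   forms and the set of Hodge duals; it commutes with d.  Since the volume form
   and the Hodge dual are unique, the flow commutes with the codifferential
   (existence is not needed: where it fails, vol and star are 0).
   Uniqueness is a pointwise statement at orthonormal frames, and rests on the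
   fact that a tensor is determined at p by its values on a frame at p. *)
Require Import Defs.
From HB Require Import structures.
From mathcomp Require Import all_boot all_order all_algebra.
From mathcomp Require Import all_classical all_reals all_analysis ring.
Set Implicit Arguments.
Unset Strict Implicit.
Unset Printing Implicit Defensive.
Import Order.TTheory GRing.Theory Num.Theory.
Import numFieldNormedType.Exports.
Local Open Scope ring_scope.


(** * Pointwise evaluation of smooth functions and fields *)

Section Evaluation.
Context {R : realType} {m : nat} (M : manifold R m).
Implicit Types (f h : Cinf M) (X Y : vect M).

(** Evaluation at a point is named so that it can carry a ring morphism structure; sums, signs and
    determinants of smooth functions are then evaluated by the generic morphism lemmas. *)
Definition evalC (p : M) (f : Cinf M) : R := f p.

Fact evalC_zmod p : zmod_morphism (evalC p). Proof. by []. Qed.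
HB.instance Definition _ p := GRing.isZmodMorphism.Build _ _ (evalC p) (evalC_zmod p).
Fact evalC_monoid p : monoid_morphism (evalC p). Proof. by []. Qed.
HB.instance Definition _ p := GRing.isMonoidMorphism.Build _ _ (evalC p) (evalC_monoid p).

Lemma Cinf_sum I (r : seq I) (Q : pred I) (F : I -> Cinf M) p :
  (\sum_(i <- r | Q i) F i) p = \sum_(i <- r | Q i) F i p.
Proof. exact: (raddf_sum (evalC p)). Qed.

Lemma Cinf_sign e p : ((-1) ^+ e : Cinf M) p = (-1) ^+ e.
Proof. by rewrite -[LHS]/(evalC p _) rmorphXn rmorphN1. Qed.

Lemma vect_sum I (r : seq I) (Q : pred I) (F : I -> vect M) f :
  (\sum_(i <- r | Q i) F i) f = \sum_(i <- r | Q i) F i f.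
Proof. by elim/big_rec2: _ => // i g X _ <-; rewrite vectD. Qed.

Lemma vectB X Y f : (X - Y) f = X f - Y f. Proof. by []. Qed.

Lemma tangent_vect X p : is_tangent p (fun f => X f p).
Proof.
have [lX dX] := vect_derivation X.
by split=> [a f h|f h]; rewrite ?lX ?dX.
Qed.

End Evaluation.

(** * Linear algebra of frames at a point *)

Section Frames.
Context {R : realType} {m : nat} {M : manifold R m}.
Implicit Types (E F : 'I_m -> vect M) (X Y : vect M) (p q : M).

Definition vcol k (E : 'I_k -> vect M) p (f : Cinf M) : 'cV[R]_k := \col_i E i f p.

Lemma mul_vcol k (a : 'rV[R]_k) (E : 'I_k -> vect M) p f :
  (a *m vcol E p f) 0 0 = \sum_i a ord0 i * E i f p.
Proof. by rewrite mxE; apply: eq_bigr => i _; rewrite mxE. Qed.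

(** The zero functional is tangent at [p], and both [a] and the zero row represent it; the
    uniqueness clause of [frame_at] identifies them. *)
Lemma frame_free p F (a : 'rV[R]_m) :
  frame_at p F -> (forall f, (a *m vcol F p f) 0 0 = 0) -> a = 0.
Proof.
move=> fF a0; have [|c [_ cU]] := fF (fun=> 0).
  by split=> [b f h|f h]; rewrite !mulr0 addr0.
rewrite -(cU a) => [|f]; last by rewrite -mul_vcol a0.
by apply: cU => f; rewrite -mul_vcol mul0mx mxE.
Qed.

Lemma frame_coords p F v : frame_at p F -> is_tangent p v ->
  exists a : 'rV[R]_m, forall f, v f = (a *m vcol F p f) 0 0.
Proof.
by move=> fF /fF [a [va _]]; exists a => f; rewrite mul_vcol.
Qed.

Lemma frame_matrix p F k (E : 'I_k -> vect M) : frame_at p F ->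
  exists C : 'M[R]_(k, m), forall f, vcol E p f = C *m vcol F p f.
Proof.
move=> fF; have h i := frame_coords fF (tangent_vect (E i) p).
have [c hc] := choice h; exists (\matrix_i c i) => f.
apply/matrixP => i j; rewrite ord1 mxE hc.
rewrite -[in LHS](rowK c i) -row_mul [LHS]mxE; congr (_ _ _).
Qed.

Lemma frame_change p F E (C : 'M[R]_m) : frame_at p F -> C \in unitmx ->
  (forall f, vcol E p f = C *m vcol F p f) -> frame_at p E.
Proof.
move=> fF Cu hC v tv; have [a va] := frame_coords fF tv.
exists (a *m invmx C); split=> [f|c hc].
  by rewrite -mul_vcol hC mulmxA mulmxKV.
apply: (canLR (mulmxK Cu)); apply/eqP; rewrite -subr_eq0; apply/eqP.
apply: (frame_free fF) => f; rewrite mulmxBl mxE -va -mulmxA -hC mxE.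
by rewrite [X in _ - X]mul_vcol -hc subrr.
Qed.

(* The values of f |-> (F_i f)(p) span R^m, since no nonzero linear form
   vanishes on them; independent values are picked one at a time. *)
Lemma frame_separation p F : frame_at p F ->
  exists f : 'I_m -> Cinf M, (\matrix_(i, j) F i (f j) p) \in unitmx.
Proof.
move=> fF; suff h k : (k <= m)%N ->
    exists f : 'I_k -> Cinf M, row_free (\matrix_(j, i) F i (f j) p).
  have [f hf] := h m (leqnn m); exists f.
  by rewrite -unitmx_tr -row_free_unit; congr row_free: hf;
    apply/matrixP => i j; rewrite !mxE.
elim: k => [|k IH] km.
  by exists (fun=> 0); rewrite -kermx_eq0 flatmx0.
have [f hf] := IH (ltnW km); set N := \matrix_(j, i) F i (f j) p in hf.
have [c c0 Nc] : exists2 c : 'cV[R]_m, c != 0 & N *m c = 0.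
  have : kermx N^T != 0.
    rewrite kermx_eq0 /row_free mxrank_tr (eqP hf); apply/negP => /eqP kE.
    by rewrite kE ltnn in km.
  case/rowV0Pn => a /sub_kermxP ha a0.
  by exists a^T; [rewrite trmx_eq0|rewrite -[N]trmxK -trmx_mul ha trmx0].
have [g hg] : exists g, (c^T *m vcol F p g) 0 0 != 0.
  apply: contrapT => /forallNP h; move/eqP: c0; apply; apply: trmx_inj.
  rewrite trmx0; apply: (frame_free fF) => g; apply/eqP/negPn/negP; exact: h.
exists (fun j : 'I_(1 + k) => if fintype.split j is inr i then f i else g).
rewrite (_ : \matrix_(_, _) _ = col_mx (vcol F p g)^T N); last first.
  apply/matrixP => j i; rewrite !mxE; case: (fintype.split j) => j'; by rewrite !mxE.
rewrite -kermx_eq0; apply/eqP/row_matrixP => i; rewrite row0.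
set a : 'rV_(1 + k) := row i _.
have aN : a *m col_mx (vcol F p g)^T N = 0 by rewrite -row_mul mulmx_ker row0.
rewrite -(hsubmxK a) mul_row_col in aN *.
have al : lsubmx a = 0.
  (* Multiplying by [c] on the right kills the old rows [N]. Only the coefficient of the new row
     remains, times a scalar that is nonzero by the choice of [g]. *)
  have /(congr1 (fun A => (A *m c) 0 0)) := aN.
  rewrite mulmxDl -!mulmxA Nc mulmx0 addr0 mul0mx [RHS]mxE mxE big_ord1.
  rewrite -[_ *m c]trmxK trmx_mul trmxK [X in _ * X]mxE => /eqP.
  rewrite mulf_eq0 (negPf hg) orbF => /eqP h.
  by apply/matrixP => i' j'; rewrite !ord1 h mxE.
rewrite al mul0mx add0r in aN.
by rewrite (row_free_inj hf (etrans aN (esym (mul0mx _ N)))) al row_mx0.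
Qed.

(** The matrix of [E] on the [f j] factors as [C *m N], with [N] that of a frame [F]. Invertibility
    of the product forces that of [N], so a tangent vector killing all the [f j] has zero
    coordinates in [F]. *)
Lemma tangent_separated q E (f : 'I_m -> Cinf M) r :
  (exists F, frame_at q F) -> (\matrix_(i, j) E i (f j) q) \in unitmx ->
  is_tangent q r -> (forall j, r (f j) = 0) -> forall h, r h = 0.
Proof.
move=> [F fF] Eu tr rf h; have [a ra] := frame_coords fF tr.
have [C hC] := frame_matrix E fF.
set N := \matrix_(i, j) F i (f j) q.
have EN : \matrix_(i, j) E i (f j) q = C *m N.
  apply/matrixP => i j; have /matrixP/(_ i 0) := hC (f j).
  by rewrite !mxE => ->; apply: eq_bigr => l _; rewrite !mxE.
have aN : a *m N = 0.
  apply/matrixP => i j; rewrite ord1 [RHS]mxE -(rf j) ra !mxE.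
  by apply: eq_bigr => l _; rewrite !mxE.
move: Eu; rewrite EN unitmx_mul => /andP[_ Nu].
by rewrite ra -(mulmxK Nu a) aN mul0mx mul0mx mxE.
Qed.

(* With D := det (E_i f_j), the field D X - \sum_i c_i E_i obtained by Cramer's
   rule kills all the f_j, so it vanishes wherever D does not; multiplying
   once more by D makes it vanish everywhere.  No bump function is needed. *)
Lemma frame_span p E X : (forall q, exists F, frame_at q F) -> frame_at p E ->
  exists (D : Cinf M) (c : 'I_m -> Cinf M), D p != 0 /\ D *: X = \sum_i c i *: E i.
Proof.
move=> Mfr fE; have [f hf] := frame_separation fE.
pose A : 'M[Cinf M]_m := \matrix_(i, j) E i (f j).
have AE q : map_mx (evalC q) A = \matrix_(i, j) E i (f j) q.
  by apply/matrixP => i j; rewrite !mxE.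
have detAE q : \det A q = \det (\matrix_(i, j) E i (f j) q).
  by rewrite -AE det_map_mx.
pose x : 'rV[Cinf M]_m := \row_j X (f j).
have [c cA] : exists c, c *m A = \det A *: x.
  by exists (x *m \adj A); rewrite -mulmxA mul_adj_mx mul_mx_scalar.
pose Y : vect M := \det A *: X - \sum_i c 0 i *: E i.
have Yf j : Y (f j) = 0.
  rewrite vectB vectZ vect_sum; have /matrixP/(_ 0 j) := cA.
  rewrite !mxE => <-; apply/eqP; rewrite subr_eq0; apply/eqP/eq_bigr => i _.
  by rewrite vectZ mxE.
have DY : \det A *: Y = 0.
  apply: vectP => h; apply: CinfP => q; rewrite vectZ CinfM.
  have [->|D0] := eqVneq (\det A q) 0; first by rewrite mul0r.
  rewrite (@tangent_separated q E f (fun h => Y h q)) ?mulr0 //.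
  - by rewrite unitmxE unitfE -detAE.
  - exact: tangent_vect.
  - by move=> j; rewrite Yf.
exists (\det A * \det A), (fun i => \det A * c 0 i); split.
  by rewrite CinfM mulf_neq0 // detAE -unitfE -unitmxE.
move: DY => /eqP; rewrite scalerBr subr_eq0 scalerA scaler_sumr => /eqP ->.
by apply: eq_bigr => i _; rewrite scalerA.
Qed.
End Frames.

(** * Tensors depend only on the values of the fields at the point *)

Section Tensoriality.
Context {R : realType} {m : nat} {M : manifold R m}.
Implicit Types (E F : 'I_m -> vect M) (X Y : vect M) (p q : M).
Implicit Types (s : seq (vect M)).
Variables (k : nat) (T : tensor M) (tT : is_tensor k T).

Lemma tensorD s1 s2 X Y : T (s1 ++ (X + Y) :: s2) = T (s1 ++ X :: s2) + T (s1 ++ Y :: s2).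
Proof. by rewrite -[X in X + Y]scale1r tT.2 mul1r. Qed.

Lemma tensor0 s1 s2 : T (s1 ++ 0 :: s2) = 0.
Proof. by apply: (addrI (T (s1 ++ 0 :: s2))); rewrite -tensorD !addr0. Qed.

Lemma tensorZ s1 s2 (u : Cinf M) X : T (s1 ++ u *: X :: s2) = u * T (s1 ++ X :: s2).
Proof. by rewrite -[u *: X]addr0 tT.2 tensor0 addr0. Qed.

Lemma tensorN s1 s2 X : T (s1 ++ (- X) :: s2) = - T (s1 ++ X :: s2).
Proof. by rewrite -scaleN1r tensorZ mulN1r. Qed.

Lemma tensorB s1 s2 X Y : T (s1 ++ (X - Y) :: s2) = T (s1 ++ X :: s2) - T (s1 ++ Y :: s2).
Proof. by rewrite -[- Y]scaleN1r addrC tT.2 mulN1r addrC. Qed.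

Lemma tensor_sum (I : finType) (u : I -> Cinf M) (X : I -> vect M) s1 s2 :
  T (s1 ++ \sum_i u i *: X i :: s2) = \sum_i u i * T (s1 ++ X i :: s2).
Proof.
elim: (index_enum I) => [|i r IH]; first by rewrite !big_nil tensor0.
by rewrite !big_cons tT.2 IH.
Qed.

Hypothesis Mframes : forall q, exists E, frame_at q E.

Lemma tensor_frame_eq0 p E : frame_at p E ->
  (forall l, size l = k -> T (map E l) p = 0) -> forall s, T s p = 0.
Proof.
move=> fE h s; have [sk|/tT.1 -> //] := eqVneq (size s) k.
(* The fields are traded for frame fields from left to right: [l] lists the indices already placed,
   [s2] the fields still to be expanded. *)
suff H s2 l : (size l + size s2 = k)%N -> T (map E l ++ s2) p = 0.
  by rewrite -[s]/(map E [::] ++ s) H.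
elim: s2 l => [|X s2 IH] l; first by rewrite addn0 cats0; apply: h.
(* [X] itself need not be a global combination of the [E i], but [D *: X] is, and the factor [D p]
   can be cancelled. *)
move=> lk; have [D [c [D0 DX]]] := frame_span X Mframes fE.
apply: (mulfI D0); rewrite mulr0 -CinfM -tensorZ DX tensor_sum Cinf_sum big1 // => i _.
by rewrite CinfM -cat_rcons -map_rcons IH ?mulr0 // size_rcons -lk addnS.
Qed.

(** Some multiple [D *: (X - Y)] with [D p != 0] is a combination of frame fields, whose
    coefficients vanish at [p] because the frame is free there. *)
Lemma tensor_local p X Y s1 s2 : (forall f, X f p = Y f p) ->
  T (s1 ++ X :: s2) p = T (s1 ++ Y :: s2) p.
Proof.
move=> XY; have [E fE] := Mframes p.
have [D [c [D0 DX]]] := frame_span (X - Y) Mframes fE.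
have c0 i : c i p = 0.
  have : \row_j c j p = 0; last by move/matrixP/(_ 0 i); rewrite !mxE.
  apply: (frame_free fE) => f; rewrite mul_vcol.
  transitivity (D p * (X - Y) f p); last by rewrite vectB CinfD CinfN XY subrr mulr0.
  rewrite -CinfM -vectZ DX vect_sum Cinf_sum; apply: eq_bigr => j _.
  by rewrite mxE vectZ CinfM.
apply/eqP; rewrite -subr_eq0 -CinfN -CinfD -tensorB; apply/eqP.
apply: (mulfI D0); rewrite mulr0 -CinfM -tensorZ DX tensor_sum Cinf_sum big1 // => i _.
by rewrite CinfM c0 mul0r.
Qed.

(** The constants [a i] extend to constant functions, giving a global field that agrees with [X] at
    [p]. *)
Lemma tensor_comb p (I : finType) (a : I -> R) (E : I -> vect M) X s1 s2 :
  (forall f, X f p = \sum_i a i * E i f p) ->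
  T (s1 ++ X :: s2) p = \sum_i a i * T (s1 ++ E i :: s2) p.
Proof.
move=> XE; rewrite (@tensor_local p X (\sum_i Ccst M (a i) *: E i)) => [|f].
  by rewrite tensor_sum Cinf_sum.
by rewrite XE vect_sum Cinf_sum.
Qed.

End Tensoriality.

(** * Alternating forms and increasing multi-indices *)

Section Alternating.
Context {R : realType} {m : nat} {M : manifold R m}.
Variables (k : nat) (T : tensor M) (fT : is_form k T).

(** Polarisation: expand the vanishing value on the repeated field [X + Y]. *)
Lemma form_swap s1 s2 (X Y : vect M) :
  T (s1 ++ X :: Y :: s2) = - T (s1 ++ Y :: X :: s2).
Proof.
have [tT aT] := fT; have := aT s1 [::] s2 (X + Y).
rewrite /= (tensorD tT) -cat_rcons (tensorD tT) cat_rcons (aT _ [::]) add0r.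
rewrite -[s1 ++ Y :: _]cat_rcons (tensorD tT) !cat_rcons (aT _ [::] _ Y) addr0.
by move=> /eqP; rewrite addr_eq0 => /eqP.
Qed.

(** Only vanishing is transported, so the sign of the permutation never has to be computed. *)
Lemma form_perm_eq0 (E : 'I_m -> vect M) p (l l' : seq 'I_m) : perm_eq l l' ->
  T (map E l) p = 0 -> T (map E l') p = 0.
Proof.
have front s1 s2 s3 X : T (s1 ++ X :: s2 ++ s3) p = 0 -> T (s1 ++ s2 ++ X :: s3) p = 0.
  elim: s2 s1 => [//|Y s2 IH] s1.
  rewrite form_swap CinfN => /eqP; rewrite oppr_eq0 => /eqP.
  by rewrite -cat_rcons => /IH; rewrite cat_rcons.
rewrite -[map E l]cat0s -[map E l']cat0s.
elim: l l' [::] => [|i l IH] l' s1; first by rewrite perm_sym => /perm_nilP ->.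
move=> pl; have il' : i \in l' by rewrite -(perm_mem pl) mem_head.
move: pl; case/splitPr: il' => l1 l2; rewrite perm_sym perm_catC /= perm_cons.
rewrite perm_catC perm_sym => pl; rewrite -cat_rcons => /(IH _ _ pl).
by rewrite cat_rcons !map_cat => /front.
Qed.

(** A list with a repeated index gives zero by alternation; a list without repetition is a
    permutation of the enumeration of its support, which has cardinal [k]. *)
Lemma form_frame_eq0 p (E : 'I_m -> vect M) :
  (forall q : M, exists F, frame_at q F) -> frame_at p E ->
  (forall A : {set 'I_m}, #|A| = k -> T [seq E i | i <- enum A] p = 0) ->
  forall s, T s p = 0.
Proof.
have [tT aT] := fT.
move=> Mf fE h; apply: (tensor_frame_eq0 tT Mf fE) => l lk.
have [ul|nl] := boolP (uniq l).
  have pl : perm_eq (enum [set i in l]) l.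
    by apply: uniq_perm => [||i]; rewrite ?enum_uniq // mem_enum inE.
  by apply: (form_perm_eq0 pl); apply: h; rewrite cardE (perm_size pl).
rewrite -[map E l]cat0s; elim: l nl [::] {lk} => [//|i l IH] /=.
rewrite negb_and negbK; have [il _|_ /= nl] := boolP (i \in l) => s1.
  by case/splitPr: il => l1 l2; rewrite map_cat aT.
by rewrite -cat_rcons IH.
Qed.
End Alternating.

(** * Families indexed by ordinals, wedge product and differential *)

Section Families.
Context {R : realType} {m : nat} {M : manifold R m}.
Implicit Types (w eta : tensor M) (s : seq (vect M)).

Lemma list_of_tnth s : list_of (tnth (in_tuple s)) = s.
Proof. exact: map_tnth_enum. Qed.

Lemma size_list_of k (E : 'I_k -> vect M) : size (list_of E) = k.
Proof. by rewrite size_map size_enum_ord. Qed.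

(** [wedge] and [extd] are indexed by ['I_(size s)]. Eliminating the equation between
    [size (list_of E)] and [k] once and for all makes their formulas available over ['I_k] without
    casts. *)
Lemma list_of_ind (Q : forall k, ('I_k -> vect M) -> seq (vect M) -> Prop) :
  (forall s, Q _ (tnth (in_tuple s)) s) ->
  forall k (E : 'I_k -> vect M), Q k E (list_of E).
Proof.
move=> h k E; have tE i : tnth (in_tuple (list_of E)) i =
    E (cast_ord (size_list_of E) i).
  rewrite (tnth_nth (E (cast_ord (size_list_of E) i))) /=.
  rewrite (nth_map (cast_ord (size_list_of E) i)).
    by congr (E _); exact: (nth_ord_enum _ (cast_ord (size_list_of E) i)).
  by rewrite size_enum_ord -[X in (_ < X)%N](size_list_of E).
move: (list_of E) (size_list_of E) tE => s sk; case: k / sk E => E tE.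
rewrite (_ : E = tnth (in_tuple s)) //; apply/funext => i.
by rewrite tE cast_ord_id.
Qed.

Lemma map_enum_full k (E : 'I_k -> vect M) (A : {set 'I_k}) :
  #|A| = k -> [seq E i | i <- enum A] = list_of E.
Proof.
move=> Ak; have -> : A = [set: 'I_k]%SET.
  by apply/eqP; rewrite eqEcard finset.subsetT cardsT card_ord Ak leqnn.
by congr map; apply: eq_enum => i; rewrite !inE.
Qed.

Lemma wedge_list w eta k (E : 'I_k -> vect M) :
  wedge w eta (list_of E) = \sum_(A : {set 'I_k}) (-1) ^+ inversions A *
    (w [seq E i | i <- enum A] * eta [seq E i | i <- enum (~: A)%SET]).
Proof. by elim/list_of_ind: E / (list_of E). Qed.

Lemma extd_list w k (E : 'I_k -> vect M) :
  extd w (list_of E) =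
  \sum_(i < k) (-1) ^+ i * E i (w [seq E j | j <- enum [set~ i]%SET]) +
  \sum_(i < k) \sum_(j < k | (i < j)%N) (-1) ^+ (i + j) *
    w (bracket (E i) (E j) :: [seq E l | l <- enum (~: [set i; j])%SET]).
Proof. by elim/list_of_ind: E / (list_of E). Qed.

Lemma tensorZE (a : R) w s : (a *: w) s = a *: w s. Proof. by []. Qed.

Lemma wedgeZr a w eta : wedge w (a *: eta) = a *: wedge w eta.
Proof.
apply/funext => s; apply: CinfP => p; rewrite tensorZE CinfZ !Cinf_sum mulr_sumr.
by apply: eq_bigr => A _; rewrite tensorZE !(CinfZ, CinfM); ring.
Qed.

Lemma wedgeB w eta eta' : wedge w (eta - eta') = wedge w eta - wedge w eta'.
Proof.
apply/funext => s; apply: CinfP => p.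
rewrite -[RHS]/(wedge w eta s p - wedge w eta' s p) !Cinf_sum -sumrB.
apply: eq_bigr => A _; rewrite -[(eta - eta') _]/(eta _ - eta' _).
by rewrite !(CinfM, CinfD, CinfN); ring.
Qed.

Lemma vectZr (X : vect M) (a : R) f : X (a *: f) = a *: X f.
Proof.
have [lX _] := vect_derivation X.
have X0 : X 0 = 0.
  by apply: (addrI (X 0)); rewrite -[X in X + _]scale1r -lX scale1r !addr0.
by rewrite -[a *: f in LHS]addr0 lX X0 addr0.
Qed.

Lemma extdZ a w : extd (a *: w) = a *: extd w.
Proof.
apply/funext => s; apply: CinfP => p; rewrite tensorZE CinfZ !CinfD !Cinf_sum mulrDr.
rewrite !mulr_sumr; congr (_ + _); apply: eq_bigr => i _.
  by rewrite tensorZE vectZr !(CinfZ, CinfM) mulrCA.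
rewrite !Cinf_sum mulr_sumr; apply: eq_bigr => j _.
by rewrite tensorZE !(CinfZ, CinfM) mulrCA.
Qed.

Lemma is_form0 k : is_form k (0 : tensor M).
Proof. by split=> //; split=> // s1 s2 u X Y; rewrite mulr0 addr0. Qed.

Lemma is_formZ k a w : is_form k w -> is_form k (a *: w).
Proof.
move=> [[ws wl] wa]; split=> [|s1 s2 s3 X]; last by rewrite tensorZE wa scaler0.
split=> [s /ws|s1 s2 u X Y]; first by rewrite tensorZE => ->; rewrite scaler0.
rewrite !tensorZE wl; apply: CinfP => p; rewrite !(CinfZ, CinfD, CinfM); ring.
Qed.

Lemma is_formB k w eta : is_form k w -> is_form k eta -> is_form k (w - eta).
Proof.
have BE s : (w - eta) s = w s - eta s by [].
move=> [[ws wl] wa] [[es el] ea]; split=> [|s1 s2 s3 X]; last by rewrite BE wa ea subrr.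
split=> [s sk|s1 s2 u X Y]; first by rewrite BE ws // es // subrr.
rewrite !BE wl el; apply: CinfP => p; rewrite !(CinfN, CinfD, CinfM); ring.
Qed.

End Families.

(** * Naturality of push-forward and pullback *)

Section Pullback.
Context {R : realType} {m : nat} {M : manifold R m}.
Implicit Types (w eta : tensor M) (s : seq (vect M)) (F G H : diffeo M M).

(** At a point of the form [F p] the inverse in [push] cancels; by [dfun_surj], identities between
    pushed fields may be checked at such points. *)
Lemma pushE F (X : vect M) f p : push F X f (F p) = X (comp_Cinf (dfun_smooth F) f) p.
Proof.
rewrite -[LHS]/(X (comp_Cinf (dfun_smooth F) f) (Defs.dinv F (F p))).
by rewrite dfunK.
Qed.

Lemma dfun_surj F q : exists p, q = F p.
Proof. by exists (Defs.dinv F q); rewrite dinvK. Qed.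

Lemma push_lin F u (X Y : vect M) :
  push F (u *: X + Y) = comp_Cinf (dinv_smooth F) u *: push F X + push F Y.
Proof. by apply: vectP => f; apply: CinfP => q. Qed.

Lemma push_bracket F (X Y : vect M) :
  push F (bracket X Y) = bracket (push F X) (push F Y).
Proof.
have c X' f : comp_Cinf (dfun_smooth F) (push F X' f) = X' (comp_Cinf (dfun_smooth F) f).
  by apply: CinfP => p; exact: pushE.
apply: vectP => f; apply: CinfP => q; have [p ->] := dfun_surj F q.
rewrite pushE -[LHS]/(X (Y _) p - Y (X _) p).
by rewrite -[RHS]/(push F X _ (F p) - push F Y _ (F p)) !pushE !c.
Qed.

(** The composite is a third diffeomorphism [H] subject to a pointwise equation, because the flow at
    time [u + v] comes as a record of its own. *)
Lemma push_comp F G H (X : vect M) : (forall p, H p = G (F p)) ->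
  push H X = push G (push F X).
Proof.
move=> HE; apply: vectP => f; apply: CinfP => q; have [p ->] := dfun_surj H q.
rewrite pushE HE !pushE; congr (X _ _); apply: CinfP => p'.
by rewrite -[LHS]/(f (H p')) HE.
Qed.

Lemma pullE F w s p : pull F w s p = w (map (push F) s) (F p).
Proof. by []. Qed.

Lemma pull_comp F G H w : (forall p, H p = G (F p)) -> pull H w = pull F (pull G w).
Proof.
move=> HE; apply/funext => s; apply: CinfP => p; rewrite !pullE HE -map_comp.
by congr (w _ _); apply: eq_map => X; exact: push_comp.
Qed.

Lemma pull_id F w : (forall p, F p = p) -> pull F w = w.
Proof.
move=> FE; apply/funext => s; apply: CinfP => p; rewrite pullE FE.
congr (w _ _); rewrite -[RHS]map_id; apply: eq_map => X.
apply: vectP => f; apply: CinfP => q; rewrite -[q in LHS]FE pushE.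
by congr (X _ _); apply: CinfP => r; rewrite -[LHS]/(f (F r)) FE.
Qed.

Lemma pullZ F (a : R) w : pull F (a *: w) = a *: pull F w.
Proof. by apply/funext => s; apply: CinfP. Qed.

Lemma pull0 F : pull F 0 = 0.
Proof. by apply/funext => s; apply: CinfP. Qed.

Lemma map_push_list_of F k (E : 'I_k -> vect M) :
  map (push F) (list_of E) = list_of (push F \o E).
Proof. by rewrite -map_comp. Qed.

Lemma pull_tensor F k w : is_tensor k w -> is_tensor k (pull F w).
Proof.
move=> [ws wl]; split=> [s sk|s1 s2 u X Y]; apply: CinfP => p.
  by rewrite pullE ws // size_map.
rewrite !(CinfD, CinfM, pullE) !map_cat /= push_lin wl CinfD CinfM.
by rewrite -[X in X * _]/(u (Defs.dinv F (F p))) dfunK.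
Qed.

Lemma pull_form F k w : is_form k w -> is_form k (pull F w).
Proof.
move=> [tw wa]; split; first exact: pull_tensor.
by move=> s1 s2 s3 X; apply: CinfP => p; rewrite pullE map_cat /= map_cat /= wa.
Qed.

Lemma pull_wedge F w eta : pull F (wedge w eta) = wedge (pull F w) (pull F eta).
Proof.
apply/funext => s; apply: CinfP => p; rewrite -(list_of_tnth s) pullE.
rewrite map_push_list_of !wedge_list !Cinf_sum; apply: eq_bigr => A _.
by rewrite !CinfM !Cinf_sign !pullE -!map_comp.
Qed.

(** Both halves of the Koszul formula are natural: the first since a pushed field differentiates a
    function as the original field differentiates its pullback, the second since pushing commutes
    with brackets. *)
Lemma pull_extd F w : pull F (extd w) = extd (pull F w).
Proof.
apply/funext => s; apply: CinfP => p; rewrite -(list_of_tnth s) pullE.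
rewrite map_push_list_of !extd_list !CinfD !Cinf_sum; congr (_ + _).
  apply: eq_bigr => i _; rewrite !CinfM !Cinf_sign pushE; congr (_ * _).
  by congr (cinf_fun (vect_fun _ _) _); apply: CinfP => q; rewrite pullE -map_comp.
apply: eq_bigr => i _; rewrite !Cinf_sum; apply: eq_bigr => j _.
by rewrite !CinfM !Cinf_sign pullE /= push_bracket -map_comp.
Qed.

End Pullback.

(** * The scalar equation of exponential growth *)

Section ExponentialGrowth.
Context {R : realType}.

Lemma is_derive_expM (a u : R) :
  is_derive u (1 : R) (fun v => expR (a * v)) (a * expR (a * u)).
Proof.
have dl : is_derive u (1 : R) (fun v => a * v) a.
  by apply: is_derive_eq; rewrite /GRing.scale /= !mulr1.
rewrite mulrC; exact: (is_derive1_comp (is_derive_expR (a * u)) dl).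
Qed.

(** The product of [h v] with [expR (- a * v)] has zero derivative, hence is constant. *)
Lemma exp_growth (h : R -> R) (a : R) :
  (forall u, is_derive u (1 : R) h (a * h u)) -> forall u, h u = expR (a * u) * h 0.
Proof.
move=> dh u; pose k v := expR (- a * v) * h v.
have dk v : is_derive v (1 : R) k 0.
  apply: (is_derive_eq (is_deriveM (is_derive_expM (- a) v) (dh v))).
  by rewrite /GRing.scale /=; ring.
have := is_derive_0_is_cst u 0 dk; rewrite /k mulr0 expR0 mul1r => <-.
by rewrite mulrA -expRD mulNr subrr expR0 mul1r.
Qed.

End ExponentialGrowth.

(** * The Euler flow and homogeneity *)

Section EulerFlow.
Context {R : realType} {n : nat} {P : manifold R n.+1} {M : manifold R n}.
Variable B : principal_bundle P M.
Notation flow := (euler_flow B).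

Lemma flowD u v p : flow (u + v) p = flow v (flow u p).
Proof. by rewrite /= addrC expRD actM ?expR_neq0. Qed.

Lemma flow0 p : flow 0 p = p.
Proof. by rewrite /= expR0 act1. Qed.

Lemma pull_flow_cancel u (w : tensor P) : pull (flow u) (pull (flow (- u)) w) = w.
Proof.
rewrite -(@pull_comp _ _ _ _ _ (flow 0)) => [|p].
  by apply: pull_id; exact: flow0.
by rewrite -flowD subrr.
Qed.

(** The Lie derivative is a condition at time [0] only; the group law moves it to every time, where
    it becomes the equation solved by [exp_growth]. Conversely the exponential is differentiated at
    [0]. *)
Lemma lie_derivative_flow (a : R) (w : tensor P) :
  is_lie_derivative flow w (a *: w) <->
  forall u, pull (flow u) w = expR (a * u) *: w.
Proof.
split=> [hw u|hw s p].
  apply/funext => s; apply: CinfP => p; rewrite tensorZE CinfZ.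
  pose h v := pull (flow v) w s p.
  have -> : w s p = h 0 by rewrite /h pull_id //; exact: flow0.
  apply: (@exp_growth _ h) => {}u.
  (* The time [u] is absorbed into the fields and the base point, so that differentiating at [u]
     amounts to differentiating at [0] there. *)
  have hE v : h v = pull (flow (v - u)) w (map (push (flow u)) s) (flow u p).
    rewrite /h (@pull_comp _ _ _ (flow u) (flow (v - u))) // => q.
    by rewrite -flowD addrC subrK.
  pose h' v := pull (flow v) w (map (push (flow u)) s) (flow u p).
  have -> : h = h' \o (fun v => v - u) by apply/funext.
  have dl : is_derive u (1 : R) (fun v => v - u) 1 by exact: is_derive_shift.
  have dw := hw (map (push (flow u)) s) (flow u p); rewrite -(subrr u) in dw.
  apply: (is_derive_eq (@is_derive1_comp R h' (fun v => v - u) u _ _ dw dl)).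
  by rewrite mulr1 /= /h' subrr pull_id //; exact: flow0.
rewrite (_ : (fun u => _) = (fun u => expR (a * u)) * cst (w s p)); last first.
  by apply/funext => u; rewrite hw tensorZE CinfZ.
have := @is_derive_expM _ a 0; rewrite mulr0 expR0 mulr1 => da.
have dc : is_derive (0 : R) (1 : R) (cst (w s p) : R -> R) 0 by exact: is_derive_cst.
have dm := is_deriveM da dc.
apply: (is_derive_eq dm).
by rewrite scaler0 add0r /GRing.scale /= mulrC.
Qed.

End EulerFlow.

(** * Decomposable forms as determinants *)

Section DetForm.
Context {R : realType} {m : nat} {M : manifold R m}.
Variables (k : nat) (alpha : 'I_k -> vect M -> Cinf M).

(** This is the wedge product of the one-forms [alpha j]. Rows are indexed by the fields, so
    multilinearity and alternation are those of the determinant in its rows. *)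
Definition det_form : tensor M := fun s =>
  if size s == k then \det (\matrix_(i < k, j < k) alpha j (nth 0 s i)) else 0.

(** On the right, [x] occurs only at position [size s1]; all other rows of the determinant are thus
    visibly independent of the inserted field. *)
Lemma nth_insert T (x0 x : T) s1 s2 i :
  nth x0 (s1 ++ x :: s2) i =
  if (i == size s1)%N then x else nth x0 (s1 ++ x0 :: s2) i.
Proof.
rewrite !nth_cat; case: ltngtP => // [|->]; last by rewrite subnn.
by rewrite -subn_gt0; case: (i - size s1)%N.
Qed.

Lemma det_form_is_form :
  (forall j (u : Cinf M) X Y, alpha j (u *: X + Y) = u * alpha j X + alpha j Y) ->
  is_form k det_form.
Proof.
move=> la; split; [split=> [s /negPf sk|s1 s2 u X Y]|move=> s1 s2 s3 X];
  rewrite /det_form ?sk //.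
  have sE Z : size (s1 ++ Z :: s2) = (size s1 + size s2).+1.
    by rewrite size_cat /= addnS.
  rewrite !sE; case: eqP => [sk|_]; last by rewrite mulr0 addr0.
  have i0k : (size s1 < k)%N by rewrite -sk ltnS leq_addr.
  rewrite -[Z in _ = _ + Z]mul1r; apply: (determinant_multilinear (i0 := Ordinal i0k)).
  - apply/rowP => j; rewrite !mxE mul1r !nth_cat /= ltnn subnn /=; exact: la.
  - apply/matrixP => i j; rewrite !mxE nth_insert [in RHS]nth_insert.
    by rewrite (negPf (_ : lift (Ordinal i0k) i != size s1 :> nat)) // eq_sym neq_lift.
  - apply/matrixP => i j; rewrite !mxE nth_insert [in RHS]nth_insert.
    by rewrite (negPf (_ : lift (Ordinal i0k) i != size s1 :> nat)) // eq_sym neq_lift.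
case: eqP => // sk.
have sE : size (s1 ++ X :: s2 ++ X :: s3) = (size s1 + (size s2 + size s3).+1).+1.
  by rewrite size_cat /= size_cat /= !addnS.
have i1k : (size s1 < k)%N by rewrite -sk sE ltnS leq_addr.
have i2k : (size s1 + (size s2).+1 < k)%N.
  by rewrite -sk sE ltnS leq_add2l ltnS leq_addr.
apply: (@determinant_alternate _ _ _ (Ordinal i1k) (Ordinal i2k)).
  by rewrite -val_eqE /= -[X in X != _]addn0 eqn_add2l.
move=> j; rewrite !mxE; congr alpha.
rewrite !nth_cat /= ltnn subnn ltnNge leq_addr /= addKn /= nth_cat ltnn.
by rewrite subnn.
Qed.

End DetForm.

(** * Orthonormal frames and uniqueness of the Hodge dual *)

Section CarrollianFrames.
Context {R : realType} {n : nat} {P : manifold R n.+1} {M : manifold R n}.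
Variables (B : principal_bundle P M) (Delta : vect P) (mu : tensor M).
Variables (g theta : tensor P).
Implicit Types (p : P) (X Y Z : vect P) (E : 'I_n.+1 -> vect P) (A I : {set 'I_n.+1}).
Hypothesis Delta_euler : is_euler B Delta.
Hypothesis g_carrollian : carrollian B g.
Hypothesis theta_connection : connection_form B Delta theta.
Notation G := (metric g theta).

(** A function pulled back from the base is constant along the flow. *)
Lemma euler_vertical : vertical B Delta.
Proof.
move=> h; apply: CinfP => p.
have := Delta_euler (comp_Cinf (proj_smooth B) h) p.
rewrite (_ : (fun u => _) = cst (h (Defs.proj B p))); last first.
  by apply/funext => u; rewrite /= proj_act ?expR_neq0.
by move=> dh; rewrite -(@derive_val _ _ _ _ _ _ _ dh) derive_cst.
Qed.

Lemma carrollian_frames (p : P) : exists E, frame_at p E.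
Proof. by have [_ _ _ /(_ p) [E fE _]] := g_carrollian; exists E. Qed.

Lemma metric_lin (u : Cinf P) X Y Z : G (u *: X + Y) Z = u * G X Z + G Y Z.
Proof.
have [tg _ _ _] := g_carrollian; have [[tt _] _ _] := theta_connection.
have := tg.2 [::] [:: Z] u X Y; have := tt.2 [::] [::] u X Y.
by rewrite /metric /= => -> ->; ring.
Qed.

Lemma metricC X Y : G X Y = G Y X.
Proof.
by have [_ gC _ _] := g_carrollian; rewrite /metric gC mulrC.
Qed.

Lemma metricNl X Y : G (- X) Y = - G X Y.
Proof.
have G0 : G 0 Y = 0.
  by apply: (addrI (G 0 Y)); rewrite -[X in X + _]mul1r -metric_lin scaler0 !addr0.
by rewrite -[- X]addr0 -scaleN1r metric_lin G0 addr0 mulN1r.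
Qed.

Lemma metric_comb p (I : finType) (a : I -> R) (E : I -> vect P) (X Y : vect P) :
  (forall f, X f p = \sum_i a i * E i f p) ->
  G X Y p = \sum_i a i * G (E i) Y p.
Proof.
have [tg _ _ _] := g_carrollian; have [[tt _] _ _] := theta_connection.
move=> XE; rewrite /metric CinfD CinfN CinfM.
rewrite (@tensor_comb _ _ _ _ _ tg carrollian_frames _ _ _ _ _ [::] [:: Y] XE).
rewrite (@tensor_comb _ _ _ _ _ tt carrollian_frames _ _ _ _ _ [::] [::] XE).
rewrite mulr_suml -sumrB; apply: eq_bigr => i _.
by rewrite CinfD CinfN CinfM; ring.
Qed.

Lemma lsign_neq0 (i : 'I_n.+1) : lsign i != 0 :> R.
Proof. by rewrite /lsign; case: ifP; rewrite ?oppr_eq0 oner_eq0. Qed.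

(** With [C] the coordinates of [E] in a frame [F], the Gram matrix of [E] has [C] as left factor.
    It is diagonal with entries [1] and [-1], so [C] is invertible. *)
Lemma orthonormal_frame p E : orthonormal_at g theta p E -> frame_at p E.
Proof.
move=> oE; have [F fF] := carrollian_frames p; have [C hC] := frame_matrix E fF.
apply: (frame_change fF _ hC).
have EF i f : E i f p = \sum_j C i j * F j f p.
  by have /matrixP/(_ i 0) := hC f; rewrite !mxE => ->;
    apply: eq_bigr => j _; rewrite !mxE.
have gram : diag_mx (\row_i lsign i) = C *m \matrix_(i, j) G (F i) (E j) p.
  apply/matrixP => i j; rewrite !mxE -mulr_natr.
  transitivity (G (E i) (E j) p); first by rewrite oE; case: eqP; rewrite ?(mulr1, mulr0).
  by rewrite (metric_comb _ (EF i)); apply: eq_bigr => k _; rewrite mxE.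
have : diag_mx (\row_i lsign i : 'rV[R]_n.+1) \in unitmx.
  by rewrite unitmxE det_diag unitfE; apply/prodf_neq0 => i _; rewrite mxE lsign_neq0.
by rewrite gram unitmx_mul => /andP[].
Qed.

(** Take a frame normalised for [g], replace its last field by [Delta], and make the others
    horizontal by subtracting their [theta]-component along [Delta]. Since [Delta] lies in the
    kernel of [g], the values of [g] do not change. *)
Lemma orthonormal_adapted p : exists E, [/\ orthonormal_at g theta p E,
  E ord_max = Delta & forall i, i != ord_max -> theta [:: E i] = 0].
Proof.
have [tg gC gK /(_ p) [F _ gF]] := g_carrollian.
have [[tt _] _ tD] := theta_connection.
have gD X : g [:: Delta; X] = 0 by move: X; apply/gK; exact: euler_vertical.
pose E i := if i == ord_max then Delta else F i - theta [:: F i] *: Delta.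
have tE i : theta [:: E i] = if i == ord_max then 1 else 0.
  rewrite /E; case: ifP => // _.
  by rewrite (tensorB tt [::] [::]) (tensorZ tt [::] [::]) /= tD mulr1 subrr.
have gE X i : g [:: X; E i] = if i == ord_max then 0 else g [:: X; F i].
  rewrite ![g [:: X; _]]gC /E; case: ifP => // _.
  by rewrite (tensorB tg [::] [:: X]) (tensorZ tg [::] [:: X]) /= gD mulr0 subr0.
exists E; split=> [i j||i /negPf im]; [|by rewrite /E eqxx|by rewrite tE im].
have c0 : (0 : Cinf P) p = 0 by []; have c1 : (1 : Cinf P) p = 1 by [].
rewrite /metric CinfD CinfN CinfM !tE gE /lsign.
have [->|jm] := eqVneq j ord_max.
  by case: eqP => _; rewrite ?c0 ?c1 ?mulr1 ?mul0r ?sub0r ?oppr0.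
rewrite c0 mulr0 subr0 gC gE; have [->|im] := eqVneq i ord_max.
  by rewrite eq_sym (negPf jm).
by rewrite gF jm andbT eq_sym; case: eqP.
Qed.

(** Wedge product of the metric duals of the [E i] for [i] in [I]. For [E] orthonormal at [p] and
    [I] of cardinal [k], it is there, up to sign, the basis form dual to [I]. *)
Definition dual_form (p : P) (E : 'I_n.+1 -> vect P) (I : {set 'I_n.+1}) k :=
  det_form (fun j : 'I_k => G (E (nth ord0 (enum I) j))).

Lemma dual_form_eq0 p E (I A : {set 'I_n.+1}) k : orthonormal_at g theta p E ->
  #|I| = k -> A != I -> dual_form p E I k [seq E i | i <- enum A] p = 0.
Proof.
move=> oE Ik AI; rewrite /dual_form /det_form size_map -cardE; case: eqP => // Ak.
have [a aA aI] : exists2 a, a \in A & a \notin I.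
  by apply/subsetPn; apply: contra AI; rewrite eqEcard Ik Ak leqnn andbT.
have sE : size (enum A) = k by rewrite -cardE.
(* An index of [A] outside [I] contributes a row that vanishes at [p]. *)
have ak : (index a (enum A) < k)%N by rewrite -sE index_mem mem_enum.
rewrite -[LHS]/(evalC p (\det _)) -det_map_mx (expand_det_row _ (Ordinal ak)).
rewrite big1 // => j _; rewrite !mxE (nth_map ord0) ?sE // nth_index ?mem_enum //.
rewrite -[Z in Z * _]/(G _ _ p) oE; case: eqP => [jE|]; last by rewrite mul0r.
by case/negP: aI; rewrite -jE -mem_enum mem_nth // -cardE Ik.
Qed.

Lemma dual_form_neq0 p E (I : {set 'I_n.+1}) k : orthonormal_at g theta p E ->
  #|I| = k -> dual_form p E I k [seq E i | i <- enum I] p != 0.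
Proof.
move=> oE Ik; rewrite /dual_form /det_form size_map -cardE Ik eqxx.
have sE : size (enum I) = k by rewrite -cardE.
rewrite -[X in X != _]/(evalC p (\det _)) -det_map_mx.
set A := map_mx _ _.
have -> : A = diag_mx (\row_i lsign (nth ord0 (enum I) i)).
  apply/matrixP => i j; rewrite !mxE (nth_map ord0) ?sE // -[LHS]/(G _ _ p) oE.
  rewrite nth_uniq ?sE ?enum_uniq // eq_sym (_ : (_ == _ :> nat) = (i == j)) //.
  by case: eqP => [->|].
by rewrite det_diag; apply/prodf_neq0 => i _; rewrite mxE lsign_neq0.
Qed.

(** Wedging the difference with the form dual to the complement [I] of [A] isolates its component on
    [A]. The wedge vanishes since both duals have the same prescribed products. *)
Lemma hodge_unique k xi s1 s2 :
  is_hodge B mu g theta k xi s1 -> is_hodge B mu g theta k xi s2 -> s1 = s2.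
Proof.
move=> [kn f1 h1] [_ f2 h2]; have fB := is_formB f1 f2.
suff T0 s p : (s1 - s2) s p = 0.
  apply/funext => s; apply: CinfP => p; apply/eqP; rewrite -subr_eq0; apply/eqP.
  exact: T0.
have [E [oE _ _]] := orthonormal_adapted p.
apply: (form_frame_eq0 fB carrollian_frames (orthonormal_frame oE)) => A Ak.
pose I := (~: A)%SET.
have Ik : #|I| = k by rewrite cardsCs finset.setCK Ak card_ord subKn.
pose eta := dual_form p E I k.
have feta : is_form k eta.
  apply: det_form_is_form => j u X Y; rewrite ![G _ (_ + _)]metricC metric_lin.
  by rewrite ![G _ (E _)]metricC.
have : wedge eta (s1 - s2) (list_of E) p = 0.
  rewrite wedgeB -[LHS]/(wedge eta s1 _ p - wedge eta s2 _ p).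
  by rewrite (h1 _ feta _ _ oE) (h2 _ feta _ _ oE) subrr.
rewrite wedge_list Cinf_sum (bigD1 I) // big1 => [|A' A'I]; last first.
  by rewrite !CinfM (dual_form_eq0 oE Ik A'I) mul0r mulr0.
rewrite !CinfM Cinf_sign finset.setCK /= addr0 => /eqP; rewrite !mulf_eq0 signr_eq0 /=.
by rewrite (negPf (dual_form_neq0 oE Ik)) => /eqP.
Qed.

End CarrollianFrames.

(** * Positive orthonormal frames and uniqueness of the volume form *)

Section VolumeUniqueness.
Context {R : realType} {n : nat} {P : manifold R n.+1} {M : manifold R n}.
Variables (B : principal_bundle P M) (Delta : vect P) (mu : tensor M).
Variables (g theta : tensor P).
Implicit Types (p : P) (E : 'I_n.+1 -> vect P).
Hypothesis Delta_euler : is_euler B Delta.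
Hypothesis mu_orientation : orientation_form mu.
Hypothesis g_carrollian : carrollian B g.
Hypothesis theta_connection : connection_form B Delta theta.

Notation low i := (widen_ord (leqnSn n) i).

Lemma enum_setC_max : enum [set~ ord_max : 'I_n.+1]%SET = [seq low i | i <- enum 'I_n].
Proof.
rewrite [LHS](@eq_filter _ _ (fun i => i != ord_max)) => [|i]; last by rewrite !inE.
rewrite -enumT enum_ordSr filter_rcons eqxx /= filter_map.
congr map; apply/all_filterP/allP => i _ /=.
by rewrite -val_eqE /= ltn_eqF.
Qed.

(** [theta] has degree one and vanishes on all fields but the last, so the only surviving shuffle
    leaves [ord_max] alone in the complement. *)
Lemma wedge_theta p E nu : is_form n nu ->
  (forall i, i != ord_max -> theta [:: E i] = 0) ->
  wedge nu theta (list_of E) p =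
  (-1) ^+ inversions [set~ ord_max : 'I_n.+1]%SET *
    (nu (list_of (fun i => E (low i))) p * theta [:: E ord_max] p).
Proof.
have [[[t0 _] _] _ _] := theta_connection.
move=> [[nu0 _] _] tE; rewrite wedge_list Cinf_sum (bigD1 [set~ ord_max]%SET) //.
rewrite big1 => [|A AM].
  by rewrite !CinfM Cinf_sign finset.setCK enum_set1 enum_setC_max -map_comp /= addr0.
rewrite !CinfM; have [/eqP/cards1P [i Ai]|nA] := eqVneq #|(~: A)%SET| 1%N.
  rewrite Ai enum_set1 /= tE ?mulr0 //; apply: contra AM => /eqP iM.
  by rewrite -iM -Ai finset.setCK.
by rewrite t0 ?mulr0 // size_map -cardE.
Qed.

Definition flip E : 'I_n.+1 -> vect P := fun i => if i == ord_max then - E i else E i.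

Lemma flip_orthonormal p E :
  orthonormal_at g theta p E -> orthonormal_at g theta p (flip E).
Proof.
move=> oE i j; have N := metricNl g_carrollian theta_connection.
have C := metricC theta g_carrollian.
rewrite /flip; have [->|im] := eqVneq i ord_max; have [->|jm] := eqVneq j ord_max.
- by rewrite N C N opprK oE eqxx.
- by rewrite N CinfN oE eq_sym (negPf jm) oppr0.
- by rewrite C N CinfN oE eq_sym (negPf im) oppr0.
- exact: oE.
Qed.

Definition pushed p (X : 'I_n -> vect P) (Y : 'I_n -> vect M) :=
  forall i h, X i (comp_Cinf (proj_smooth B) h) p = Y i h (Defs.proj B p).

(** Each projected tangent vector is expanded in a frame at the image point; constant coefficients
    turn it into a global field on [M] with the right value there. *)
Lemma exists_pushed p (X : 'I_n -> vect P) : exists Y, pushed p X Y.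
Proof.
have [_ /(_ (Defs.proj B p)) [F fF _]] := mu_orientation.
have tX i : is_tangent (Defs.proj B p) (fun h => X i (comp_Cinf (proj_smooth B) h) p).
  have [lX dX] := tangent_vect (X i) p; split=> [a f h|f h].
    by rewrite -lX; congr (cinf_fun (vect_fun _ _) _); exact: CinfP.
  rewrite -[RHS](dX (comp_Cinf (proj_smooth B) f) (comp_Cinf (proj_smooth B) h)).
  by congr (cinf_fun (vect_fun _ _) _); exact: CinfP.
have [a ha] := choice (fun i => frame_coords fF (tX i)).
exists (fun i => \sum_j Ccst M (a i ord0 j) *: F j) => i h.
rewrite ha mul_vcol vect_sum Cinf_sum; apply: eq_bigr => j _.
by rewrite vectZ CinfM.
Qed.

(* By submersivity the n fields complementing the vertical Delta project onto a
   spanning family of the n-dimensional tangent space of M. *)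
Lemma mu_pushed_neq0 p E (Y : 'I_n -> vect M) :
  orthonormal_at g theta p E -> E ord_max = Delta ->
  pushed p (fun i => E (low i)) Y -> mu (list_of Y) (Defs.proj B p) != 0.
Proof.
move=> oE ED pY; have [fmu Mfr] := mu_orientation.
have [F fF muF] := Mfr (Defs.proj B p).
have fE := orthonormal_frame g_carrollian theta_connection oE.
have [a ha] := frame_matrix Y fF.
have lift_F j : exists b : 'rV[R]_n, forall h,
    F j h (Defs.proj B p) = (b *m vcol Y (Defs.proj B p) h) 0 0.
  (* Lift [F j] to [P] and expand the lift in [E]; its last coordinate drops out on projection
     because [Delta] is vertical. *)
  have [v tv hv] := proj_submersion (tangent_vect (F j) (Defs.proj B p)).
  have [b hb] := frame_coords fE tv.
  exists (\row_i b 0 (low i)) => h; rewrite -hv hb !mul_vcol big_ord_recr /=.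
  rewrite ED euler_vertical // mulr0 addr0; apply: eq_bigr => i _.
  by rewrite mxE pY.
have [b hb] := choice lift_F.
have ba : (\matrix_j b j) *m a = 1%:M.
  apply/row_matrixP => j; rewrite row_mul rowK; apply/eqP; rewrite -subr_eq0; apply/eqP.
  apply: (frame_free fF) => h; rewrite mulmxBl mxE -mulmxA -ha -hb.
  by rewrite [Z in _ + Z]mxE -row_mul mul1mx !mxE subrr.
have [_ au] := mulmx1_unit ba.
apply: contra_neq muF => muY.
apply: (form_frame_eq0 fmu _ (frame_change fF au ha)) => [q|A An].
  by have [F' fF' _] := Mfr q; exists F'.
by rewrite map_enum_full.
Qed.

(** An adapted orthonormal frame is positive, or becomes so once its last field changes sign. *)
Lemma exists_positive p :
  exists E, orthonormal_at g theta p E /\ positive_at B mu theta p E.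
Proof.
have [E [oE ED tE]] := orthonormal_adapted Delta_euler g_carrollian theta_connection p.
have [Y pY] := exists_pushed p (fun i => E (low i)).
have [[tt _] _ tD] := theta_connection.
(* By [wedge_theta], this is the value at [E] of the wedge of any pullback [nu] of [mu] with
   [theta]; its sign is therefore common to all [nu]. *)
pose c := (-1) ^+ inversions [set~ ord_max : 'I_n.+1]%SET *
  mu (list_of Y) (Defs.proj B p).
have c0 : c != 0 by rewrite mulf_neq0 ?signr_eq0 ?(mu_pushed_neq0 oE ED).
have pos E' : (forall i, E' (low i) = E (low i)) ->
    (forall i, i != ord_max -> theta [:: E' i] = 0) ->
    0 < c * theta [:: E' ord_max] p -> positive_at B mu theta p E'.
  move=> E'E tE' cpos nu [fnu nuE]; rewrite wedge_theta // (nuE _ _ Y) ?mulrA // => i h.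
  by rewrite E'E pY.
have [cp|cn] := ltP 0 c.
  exists E; split=> //; apply: pos => //; by rewrite ED tD mulr1.
exists (flip E); split; first exact: flip_orthonormal.
have lowm i : (low i == ord_max) = false by rewrite -val_eqE /= ltn_eqF.
apply: pos => [i|i im|]; rewrite /flip ?lowm ?(negPf im) ?eqxx //; first exact: tE.
rewrite (tensorN tt [::] [::]) /= ED tD -[_ p]/(- 1) mulrN1 oppr_gt0.
by rewrite lt_neqAle c0.
Qed.

(** A form of top degree is determined at [p] by its value on a single frame, here a positive
    orthonormal one. *)
Lemma vol_unique v v' : is_vol B mu g theta v -> is_vol B mu g theta v' -> v = v'.
Proof.
move=> [fv hv] [fv' hv']; have fB := is_formB fv fv'.
suff T0 s p : (v - v') s p = 0.
  apply/funext => s; apply: CinfP => p; apply/eqP; rewrite -subr_eq0; apply/eqP.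
  exact: T0.
have [E [oE pE]] := exists_positive p.
have fE := orthonormal_frame g_carrollian theta_connection oE.
apply: (form_frame_eq0 fB (carrollian_frames g_carrollian) fE) => A An.
rewrite map_enum_full //.
by rewrite -[LHS]/(v (list_of E) p - v' (list_of E) p) hv // hv' // subrr.
Qed.

End VolumeUniqueness.

(** * Invariance of the volume form, Hodge star and codifferential *)

Section FlowInvariance.
Context {R : realType} {n : nat} {P : manifold R n.+1} {M : manifold R n}.
Variables (B : principal_bundle P M) (Delta : vect P) (mu : tensor M).
Variables (g theta : tensor P).
Hypothesis Delta_euler : is_euler B Delta.
Hypothesis mu_orientation : orientation_form mu.
Hypothesis g_carrollian : carrollian B g.
Hypothesis theta_connection : connection_form B Delta theta.
Hypothesis g_killing : is_lie_derivative (euler_flow B) g 0.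
Implicit Types (p : P) (E : 'I_n.+1 -> vect P) (xi sigma : tensor P) (k : nat).
Notation flow := (euler_flow B).
Notation vol := (vol B mu g theta).
Notation star := (star B mu g theta).

Lemma pull_flow_metric u p X Y :
  metric g theta (push (flow u) X) (push (flow u) Y) (flow u p) = metric g theta X Y p.
Proof.
have gu : pull (flow u) g = g.
  (* The Killing equation is homogeneity of weight zero, its right-hand side [0] being read as
     [0 *: g]. *)
  have [h _] := lie_derivative_flow B 0 g.
  by rewrite h ?mul0r ?expR0 ?scale1r // scale0r.
have [_ tu _] := theta_connection; have {}tu : pull (flow u) theta = theta := tu _ _.
by rewrite /metric !CinfD !CinfN !CinfM -[in RHS]gu -[in RHS]tu.
Qed.

Lemma push_orthonormal u p E : orthonormal_at g theta p E ->
  orthonormal_at g theta (flow u p) (push (flow u) \o E).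
Proof. by move=> oE i j; exact: etrans (pull_flow_metric _ _ _ _) (oE i j). Qed.

Lemma proj_flow u p : Defs.proj B (flow u p) = Defs.proj B p.
Proof. by rewrite /= proj_act ?expR_neq0. Qed.

(** The flow moves points within fibres, so a field and its push-forward project to the same tangent
    vector of [M]. *)
Lemma pull_is_pullback u nu : is_pullback B mu nu -> is_pullback B mu (pull (flow u) nu).
Proof.
move=> [fnu hnu]; split=> [|p X Y XY]; first exact: pull_form.
rewrite pullE map_push_list_of (hnu _ _ Y) => [|i h]; rewrite proj_flow //.
rewrite -[(_ \o X) i]/(push (flow u) (X i)) pushE -XY.
by congr (cinf_fun (vect_fun _ _) _); apply: CinfP => q;
  congr (h _); exact: proj_flow.
Qed.

Lemma push_positive u p E : positive_at B mu theta p E ->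
  positive_at B mu theta (flow u p) (push (flow u) \o E).
Proof.
have [_ tu _] := theta_connection; have {}tu : pull (flow u) theta = theta := tu _ _.
move=> pE nu /(pull_is_pullback u)/pE.
by rewrite -[in X in wedge _ X]tu -pull_wedge pullE map_push_list_of.
Qed.

Lemma pull_is_vol u v : is_vol B mu g theta v -> is_vol B mu g theta (pull (flow u) v).
Proof.
move=> [fv hv]; split=> [|p E oE pE]; first exact: pull_form.
rewrite pullE map_push_list_of hv //; first exact: push_orthonormal.
exact: push_positive.
Qed.

Lemma pull_vol u : pull (flow u) vol = vol.
Proof.
rewrite /Defs.vol; case: xgetP => [v _ vv|_]; last exact: pull0.
exact: (vol_unique Delta_euler mu_orientation g_carrollian theta_connection
  (pull_is_vol u vv) vv).
Qed.

(** A test form [eta] is the pullback at time [u] of its pullback at time [- u]; the identity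
    defining the dual is applied to the latter at [flow u p], on the pushed frame. *)
Lemma pull_is_hodge u k xi sigma : is_hodge B mu g theta k xi sigma ->
  is_hodge B mu g theta k (pull (flow u) xi) (pull (flow u) sigma).
Proof.
move=> [kn fs hs]; split=> // [|eta feta p E oE s]; first exact: pull_form.
rewrite -[eta in LHS](pull_flow_cancel B u) -pull_wedge pullE.
rewrite (hs _ (pull_form _ feta) _ _ (push_orthonormal u oE)) -[in RHS](pull_vol u).
rewrite [in RHS]pullE; congr (_ * _); apply: eq_bigr => A _; congr (_ * (_ * _)).
  by rewrite (map_comp (push _)) -pullE pull_flow_cancel.
by rewrite (map_comp (push _)) -pullE.
Qed.

Lemma is_hodgeZ (c : R) k xi sigma : is_hodge B mu g theta k xi sigma ->
  is_hodge B mu g theta k (c *: xi) (c *: sigma).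
Proof.
move=> [kn fs hs]; split=> // [|eta feta p E oE s]; first exact: is_formZ.
rewrite wedgeZr tensorZE CinfZ (hs _ feta _ _ oE) mulrA; congr (_ * _).
rewrite /inner mulr_sumr; apply: eq_bigr => A _.
by rewrite tensorZE CinfZ; ring.
Qed.

Lemma star_unique k xi sigma : is_hodge B mu g theta k xi sigma -> star k xi = sigma.
Proof.
move=> hs; apply: xget_unique => // tau ht.
exact: (hodge_unique Delta_euler g_carrollian theta_connection ht hs).
Qed.

(** If [xi] has a dual, both sides are Hodge duals of [c *: xi] and uniqueness applies; otherwise
    [star] takes its default value [0] on both sides. *)
Lemma pull_star u (c : R) k xi : pull (flow u) xi = c *: xi ->
  pull (flow u) (star k xi) = c *: star k xi.
Proof.
move=> xic; have [[sigma hs]|ns] :=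
    pselect (exists sigma, is_hodge B mu g theta k xi sigma).
  rewrite (star_unique hs); have := pull_is_hodge u hs; rewrite xic => hp.
  exact: (hodge_unique Delta_euler g_carrollian theta_connection hp (is_hodgeZ c hs)).
rewrite /Defs.star xgetPN ?pull0 ?scaler0 // => sigma hs; apply: ns.
by exists sigma.
Qed.

Lemma star_form k xi : (k <= n.+1)%N -> is_form (n.+1 - k) (star k xi).
Proof.
by move=> kn; rewrite /Defs.star; case: xgetP => [v _ []|_] //; exact: is_form0.
Qed.

Lemma star_gt k xi : (n.+1 < k)%N -> star k xi = 0.
Proof.
by rewrite ltnNge => /negP nk; rewrite /Defs.star xgetPN // => sigma [].
Qed.

Lemma star0 k : star k 0 = 0.
Proof.
rewrite /Defs.star; case: xgetP => [sigma _ hs|//].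
have := is_hodgeZ 0 hs; rewrite !scale0r => /star_unique <-.
by rewrite (star_unique hs).
Qed.

(** Truncated subtraction leaves two boundary cases. For [k] above [n.+1] the inner star is zero;
    for [k = 0] the outer star is taken in degree [n.+2] and is zero. *)
Lemma codiff_form k xi : is_form k.-1 (codiff B mu g theta k xi).
Proof.
apply: is_formZ; case: (leqP k n.+1) => [kn|nk]; last first.
  rewrite [star k xi]star_gt // -(scale0r (0 : tensor P)) extdZ scale0r star0.
  exact: is_form0.
case: k kn => [|k] kn; first by rewrite star_gt //; exact: is_form0.
rewrite (_ : k.+1.-1 = (n.+1 - (n.+1 - k.+1).+1)%N).
  by apply: star_form; rewrite subSS ltnS leq_subr.
by rewrite !subSS subKn.
Qed.

Lemma pull_codiff u (c : R) k xi : pull (flow u) xi = c *: xi ->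
  pull (flow u) (codiff B mu g theta k xi) = c *: codiff B mu g theta k xi.
Proof.
move=> xic; rewrite pullZ scalerA mulrC -scalerA; congr (_ *: _).
by apply: pull_star; rewrite pull_extd (pull_star k xic) extdZ.
Qed.

End FlowInvariance.

Theorem proposition2p8 (R : realType) (n : nat)
  (P : manifold R n.+1) (M : manifold R n)
  (B : principal_bundle P M) (Delta : vect P) (Delta_euler : is_euler B Delta)
  (mu : tensor M) (mu_orientation : orientation_form mu)
  (g : tensor P) (g_carrollian : carrollian B g)
  (theta : tensor P) (theta_connection : connection_form B Delta theta)
  (g_killing : is_lie_derivative (euler_flow B) g 0)
  (k : nat) (lambda : R) (xi : tensor P) :
  is_form k xi -> homogeneous B lambda xi ->
  is_form k.-1 (codiff B mu g theta k xi) /\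
  homogeneous B lambda (codiff B mu g theta k xi).
Proof.
move=> _ /lie_derivative_flow xih; split.
  exact: (codiff_form mu Delta_euler g_carrollian theta_connection).
apply/lie_derivative_flow => u.
exact: (pull_codiff Delta_euler mu_orientation g_carrollian theta_connection
  g_killing k (xih u)).
Qed.
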